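(* Let $n\ge 3$ be odd. A sequence $(a_1,\ldots,a_n;b_1,\ldots,b_n;s)$ of positive integers, with $a_1=\ldots=a_n=a$ and $b_1=\ldots=b_n=b$, is an essential Betti sequence if and only if 1) $s=n(b-a)$; 2) $na<(n-1)b\le (n+1)a$.
   Context: $k$ is a field. A sequence $(a_1,\ldots,a_n;b_1,\ldots,b_n;s)$ is called an essential Betti sequence if there is a homogeneous ideal $I$ of height at least $2$ in a standard graded polynomial ring $R=k[x_1,\ldots,x_r]$ for some $r\ge 3$ (the number of variables is not prescribed) such that $R/I$ has a graded minimal free resolution $$0\to R(-s)\to\bigoplus_{j=1}^n R(-b_j)\to\bigoplus_{i=1}^n R(-a_i)\to R\to R/I\to 0.$$ *)

(* Defs.v *)
From HB Require Import structures.
From mathcomp Require Import all_boot all_order all_algebra.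
From mathcomp Require Import ring_quotient.
From mathcomp Require Import ssrcomplements freeg mpoly.

Set Implicit Arguments.
Unset Strict Implicit.
Unset Printing Implicit Defensive.

Import GRing.Theory.
Local Open Scope ring_scope.

Section Height.
Variable R : comNzRingType.
Implicit Types I P : {pred R}.

(* The library's [idealr_closed] includes properness ([1 \notin I]).          *)
Definition prime_ideal P : Prop := idealr_closed P /\ prime_idealr_closed P.

Definition strict_subpred (I J : {pred R}) : Prop :=
  {subset I <= J} /\ exists2 x, x \in J & x \notin I.

(* A strict chain of primes Q 0 < Q 1 < ... < Q h = P.                        *)
Definition prime_height_ge (h : nat) P : Prop :=
  exists Q : 'I_h.+1 -> {pred R},
    [/\ forall i, prime_ideal (Q i),
        forall i j : 'I_h.+1, (i < j)%N -> strict_subpred (Q i) (Q j)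
      & Q ord_max =i P].

Definition height_ge (h : nat) I : Prop :=
  forall P, prime_ideal P -> {subset I <= P} -> prime_height_ge h P.

End Height.

Section GradedResolution.
Variables (k : fieldType) (r : nat).
Local Notation R := {mpoly k[r]}.

(* Properness, built into [idealr_closed], costs nothing below: minimality of *)
(* the resolution already forces I into (x_1, ..., x_r).                      *)
Definition homogeneous_ideal (I : {pred R}) : Prop :=
  idealr_closed I /\
  forall (p : R) (d : nat), p \in I -> pihomog mdeg d p \in I.

(* The free module F = \bigoplus_i R(-e i) consists of column vectors; its    *)
(* i-th basis vector has degree e i, so F_d = \bigoplus_i R_(d - e i).        *)
Definition in_degree n (e : 'I_n -> nat) (d : nat) (v : 'cV[R]_n) : Prop :=
  forall i, if (e i <= d)%N then v i 0 \is (d - e i)%N.-homog else v i 0 == 0.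

(* The R-linear map v |-> M *m v from \bigoplus_j R(-f j) to                  *)
(* \bigoplus_i R(-e i) is homogeneous of degree 0.                            *)
Definition graded_map m n (e : 'I_m -> nat) (f : 'I_n -> nat)
    (M : 'M[R]_(m, n)) : Prop :=
  forall (d : nat) (v : 'cV[R]_n), in_degree f d v -> in_degree e d (M *m v).

(* All entries lie in the ideal (x_1, ..., x_r).                              *)
Definition minimal_map m n (M : 'M[R]_(m, n)) : Prop :=
  forall i j, (M i j)@_0%MM = 0.

Definition exact_at m n p (M : 'M[R]_(m, n)) (N : 'M[R]_(n, p)) : Prop :=
  forall v : 'cV[R]_n, M *m v = 0 <-> exists w : 'cV[R]_p, v = N *m w.

(* R/I has a graded minimal free resolution                                   *)
(*   0 -> R(-s) -> \bigoplus_j R(-b j) -> \bigoplus_i R(-a i) -> R -> R/I -> 0*)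
(* with differentials d3, d2, d1; exactness at R says that the image of d1    *)
(* is the kernel I of R -> R/I.                                               *)
Definition has_resolution n (I : {pred R}) (a b : 'I_n -> nat) (s : nat)
    : Prop :=
  exists (d1 : 'M[R]_(1, n)) (d2 : 'M[R]_(n, n)) (d3 : 'M[R]_(n, 1)),
    [/\ [/\ graded_map (fun=> 0%N) a d1, graded_map a b d2
          & graded_map b (fun=> s) d3],
        [/\ minimal_map d1, minimal_map d2 & minimal_map d3]
      & [/\ forall p : R, p \in I <-> exists v : 'cV[R]_n, p%:M = d1 *m v,
            exact_at d1 d2,
            exact_at d2 d3
          & forall u : 'cV[R]_1, d3 *m u = 0 -> u = 0]].

End GradedResolution.

Definition essential_Betti_sequence (k : fieldType) (n : nat)
    (a b : 'I_n -> nat) (s : nat) : Prop :=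
  exists2 r : nat, (3 <= r)%N &
  exists I : {pred {mpoly k[r]}},
    [/\ homogeneous_ideal I, height_ge 2 I & has_resolution I a b s].

(* Main.v *)
Require Import Defs.
From HB Require Import structures.
From mathcomp Require Import all_boot all_order all_algebra.
From mathcomp Require Import perm ring_quotient.
From mathcomp Require Import ssrcomplements freeg mpoly.
From mathcomp Require Import ring zify.
From Stdlib Require Import Classical ClassicalEpsilon.

Set Implicit Arguments.
Unset Strict Implicit.
Unset Printing Implicit Defensive.

Import GRing.Theory.
Local Open Scope ring_scope.

(** Let f, D and v be the three differentials of the resolution, d = b - a the
    degree of the entries of D and c = s - b the degree of the entries of v.  In
    these terms the two numerical conditions say that (n - 1) d = a + c and
    0 < c <= a.

    Necessity.  Exactness makes D singular with kernel spanned by v, so its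
    cofactors factor as v_j mu_i, where mu is a left kernel vector of D and hence
    proportional to f ([exact_minors]).  Height at least 2 forbids a common factor
    of the entries of f, and exactness bounds mu from above: mu_i divides a power
    of f_i.  So mu and f should be associates, and then the degree of the
    cofactors gives (n - 1) d = a + c.  Unique factorization in several variables
    is avoided by singling out one variable X_i at a time.  Up to nonzero factors
    free of X_i, the ring is a principal ideal domain; an irreducible common
    divisor of the entries of f in it would pull back to a prime ideal of height at
    most 1 containing I ([irred_pullback_height]).  Hence mu and f agree up to
    factors free of X_i ([family_eqp]), and their leading monomials have the same
    exponent of X_i.  As this holds for every i, the leading monomials are equal.
    Positivity of c is minimality, and c <= a holds because multiplication by f_i
    is null-homotopic on the resolution, which puts f_i into the ideal generated
    by the entries of v ([exact_sub_last]).

    Sufficiency.  With n = 2M + 1 the conditions give c <= M d; let m be such that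
    (m - 1) d < c <= m d.  When c = m d and n = 2m + 1, take for D the tridiagonal
    matrix with rows (z^d, -y^d, x^d), except the middle one (z^d, 0, -x^d).
    Reversing the order of the rows and changing signs makes it skew-symmetric, and
    f and v are, up to the same changes, its vector of Pfaffians; they are
    expressed by the continuants of the matrix.  To decrease c, the first and the
    last row of this matrix are given the smaller degree t = c - (m - 1) d, and
    monomials of degree h = d - t, powers of x, z and of a fourth variable w, bring
    the entries back to degree d.  To increase n, a bidiagonal block with entries
    -y^d and x^d is appended, on which v vanishes.

    The resulting complex is exact because nonzero superdiagonal entries determine
    the adjugate of a tridiagonal matrix from its two kernel vectors
    ([hess_adj]: it is v f up to sign), because v contains the regular sequence
    x^c, z^c, y^c + x z A, and because f has grade 2 ([exact_of_grades], a case of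
    the criterion of Buchsbaum and Eisenbud). *)

(** * Division of univariate polynomials up to scalars *)

Section PseudoDivision.
Variable A : idomainType.
Implicit Types p q t u : {poly A}.

Lemma irredp_dvd_mul u p q :
  irreducible_poly u -> u %| p * q -> (u %| p) || (u %| q).
Proof.
move=> [u_gt1 irru] upq.
have [/eqP g1|g1] := boolP (size (gcdp u p) == 1%N).
  by rewrite -(@Gauss_dvdpr _ q p) ?upq ?orbT // /coprimep g1.
have := irru _ g1 (dvdp_gcdl u p).
by move=> /eqp_dvdl <-; rewrite dvdp_gcdr.
Qed.

Lemma irredp_dvd_exp u p e : irreducible_poly u -> u %| p ^+ e -> u %| p.
Proof.
move=> irru; elim: e => [|e IHe].
  by rewrite expr0 dvdp1 => /eqP su; case: irru; rewrite su.
by rewrite exprS => /(irredp_dvd_mul irru) /orP[|/IHe].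
Qed.

(** A divisor of least degree among the nonconstant ones is irreducible. *)
Lemma exists_irredp_dvd p :
  (1 < size p)%N -> exists2 u, irreducible_poly u & u %| p.
Proof.
have [n] := ubnP (size p); elim: n p => // n IHn p lepn p_gt1.
have [irrp|nirr] := classic (irreducible_poly p); first by exists p.
have [q /= [q1 qp neq]] : exists q, [/\ size q != 1%N, q %| p & ~~ (q %= p)].
  apply: NNPP => noq; apply: nirr; split=> // q q1 qp.
  by apply: contraT => neq; case: noq; exists q.
have p0 : p != 0 by rewrite -size_poly_gt0 ltnW.
have ltqp : (size q < size p)%N.
  by rewrite ltn_neqAle dvdp_leq // andbT dvdp_size_eqp.
have q0 : q != 0 by apply: contraTneq qp => ->; rewrite dvd0p.
have q_gt1 : (1 < size q)%N by rewrite ltn_neqAle eq_sym q1 size_poly_gt0.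
have [u irru uq] := IHn q (leq_trans ltqp lepn) q_gt1.
by exists u => //; apply: dvdp_trans uq qp.
Qed.

Lemma irredp_valuation u q : irreducible_poly u -> q != 0 ->
  exists (e : nat) (c : A) t,
    [/\ c != 0, c *: q = u ^+ e * t & ~~ (u %| t)].
Proof.
move=> irru; have [n] := ubnP (size q); elim: n q => // n IHn q leqn q0.
have [|nuq] := boolP (u %| q); last first.
  by exists 0%N, 1, q; rewrite oner_eq0 scale1r expr0 mul1r.
case/Pdiv.Idomain.dvdpP=> -[c q'] /= c0 defq.
have q'0 : q' != 0.
  apply: contraNneq q0 => q'0; move/eqP: defq.
  by rewrite q'0 mul0r scale_poly_eq0 (negbTE c0).
have [ugt1 _] := irru.
have ltq1 : (size q' < size q)%N.
  rewrite -(size_scale q c0) defq size_mul ?(irredp_neq0 irru) //.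
  by case: (size u) ugt1 => [|[|k]] // _; rewrite !addnS /= ltnS leq_addr.
have [e [c' [t [c'0 deft nut]]]] := IHn q' (leq_trans ltq1 leqn) q'0.
exists e.+1, (c' * c), t; split=> //; first by rewrite mulf_neq0.
by rewrite -scalerA defq scalerAl deft exprSr mulrAC.
Qed.

(** This replaces the cancellation of a greatest common divisor of the family:
    the irreducible factors of p are moved one by one from F to q. *)
Lemma dvdp_of_family (I : finType) (F : I -> {poly A}) p q :
    (forall u, irreducible_poly u -> exists i, ~~ (u %| F i)) ->
  (forall i, p %| q * F i) -> p %| q.
Proof.
move=> coF dvF; have [n] := ubnP (size p).
elim: n p q dvF => // n IHn p q dvF lepn.
have [p0|p0] := eqVneq p 0.
  have irrX : irreducible_poly ('X - 0%:P : {poly A}) by apply: irredp_XsubC.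
  have [i nXF] := coF _ irrX; have := dvF i.
  rewrite p0 !dvd0p mulf_eq0 => /orP[//|/eqP F0].
  by rewrite F0 dvdp0 in nXF.
have [p1|p_gt1] := leqP (size p) 1%N.
  have /eqP sp1 : size p == 1%N by rewrite eqn_leq p1 size_poly_gt0.
  by apply: dvdp_trans (dvd1p q); rewrite dvdp1 sp1.
have [u irru up] := exists_irredp_dvd p_gt1.
have [i0 nuF] := coF u irru.
have uq : u %| q.
  by have /(irredp_dvd_mul irru) := dvdp_trans up (dvF i0); rewrite (negbTE nuF) orbF.
have u0 := irredp_neq0 irru.
case/Pdiv.Idomain.dvdpP: up => -[c p'] /= c0 defp.
case/Pdiv.Idomain.dvdpP: uq => -[c' q'] /= c'0 defq.
rewrite -(dvdpZl _ _ c0) -(dvdpZr _ _ c'0) defp defq dvdp_mul2r //.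
have ltp1 : (size p' < size p)%N.
  have p'0 : p' != 0.
    apply: contraNneq p0 => p'0; move/eqP: defp.
    by rewrite p'0 mul0r scale_poly_eq0 (negbTE c0).
  have [ugt1 _] := irru.
  rewrite -(size_scale p c0) defp size_mul //.
  by case: (size u) ugt1 => [|[|k]] // _; rewrite !addnS /= ltnS leq_addr.
apply: IHn; last exact: leq_trans ltp1 lepn.
move=> i; rewrite -(dvdp_mul2r _ _ u0) -defp mulrAC -defq.
by rewrite -scalerAl dvdpZl // dvdpZr.
Qed.

(** Divisibility of M i by F i comes from proportionality and the absence of a
    common factor; an irreducible factor of the quotient would divide every M j,
    hence every power of F j, and so be a common factor again. *)
Lemma family_eqp (I : finType) (F M : I -> {poly A}) N i :
    (forall u, irreducible_poly u -> exists j, ~~ (u %| F j)) ->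
    (forall i j, M i * F j = M j * F i) ->
    (forall i, exists de, M i * de = F i ^+ N) ->
  F i != 0 -> M i %= F i.
Proof.
move=> coF MF MN Fi0.
have : F i %| M i by apply: (dvdp_of_family coF) => j; rewrite MF dvdp_mulIr.
case/Pdiv.Idomain.dvdpP=> -[c la] /= c0 defM.
have Mi0 : M i != 0.
  have [de] := MN i; apply: contra_eq_neq => ->.
  by rewrite mul0r eq_sym expf_neq0.
have la0 : la != 0.
  apply: contraNneq Mi0 => la0; move/eqP: defM.
  by rewrite la0 mul0r scale_poly_eq0 (negbTE c0).
have defMj j : c *: M j = la * F j.
  by apply: (mulIf Fi0); rewrite -scalerAl -MF scalerAl defM mulrAC.
have [la1|la_gt1] := leqP (size la) 1%N; last first.
  have [u irru ula] := exists_irredp_dvd la_gt1.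
  have [j /negP[]] := coF u irru; have [de MjN] := MN j.
  apply: (irredp_dvd_exp (e := N) irru); rewrite -MjN dvdp_mulr //.
  by rewrite -(dvdpZr _ _ c0) defMj dvdp_mulr.
apply/eqpP; exists (c, la`_0) => /=.
  by rewrite c0 -polyC_eq0 -size1_polyC.
by rewrite defM {1}(size1_polyC la1) mul_polyC.
Qed.

End PseudoDivision.

Lemma prime_ideal_exp (R : idomainType) (Q : {pred R}) x e :
  prime_ideal Q -> x ^+ e \in Q -> x \in Q.
Proof.
case=> -[_ Q1 _] primeQ; elim: e => [|e IHe]; first by rewrite expr0 (negbTE Q1).
by rewrite exprS => /primeQ /orP[|/IHe].
Qed.

Lemma zero_prime_ideal (S : idomainType) : prime_ideal (pred1 (0 : S)).
Proof.
split; last by move=> p1 p2; rewrite !inE mulf_eq0.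
split=> [||p p1 p2]; rewrite !inE ?oner_eq0 //.
by move=> /eqP-> /eqP->; rewrite mulr0 addr0.
Qed.

(** Divisibility by u is meant up to nonzero scalars of A, so the preimage of the
    multiples of u is the contraction of a prime ideal of the polynomials over the
    fraction field of A. *)
Section PrincipalPrimes.
Variables (R A : idomainType) (phi : {rmorphism R -> {poly A}}).
Hypotheses (phi_inj : injective phi) (phi_surj : forall p, exists r, phi r = p).
Variable u : {poly A}.
Hypothesis irru : irreducible_poly u.

Let P : {pred R} := [pred r | u %| phi r].

Lemma irred_pullback_prime : prime_ideal P.
Proof.
have [ugt1 _] := irru; split; last first.
  by move=> x y; rewrite !inE rmorphM; apply: irredp_dvd_mul.
split=> [||a x y].
- by rewrite inE rmorph0 dvdp0.
- by rewrite inE rmorph1 dvdp1; case: (size u) ugt1 => [|[]].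
- by rewrite !inE rmorphD rmorphM => ux uy; rewrite dvdp_add // dvdp_mull.
Qed.

(** In a chain Q0 < Q1 < P, take q in Q1 but not in Q0 and write it, up to a
    scalar, as u ^+ e * t with t prime to u.  If x lies in P but not in Q1, then
    x ^+ e * t is, up to a scalar, a multiple of q and so lies in Q1; but neither x,
    nor t, nor a nonzero scalar does. *)
Lemma irred_pullback_height : ~ prime_height_ge 2 P.
Proof.
case=> Q [primeQ ltQ topQ].
have [_ [q Q1q Q0q]] := ltQ ord0 (Ordinal (isT : 1 < 3)%N) isT.
have [sQ1 [f Q2f Q1f]] := ltQ (Ordinal (isT : 1 < 3)%N) ord_max isT.
set Q1 := Q (Ordinal _) in Q1q Q1f sQ1.
have primeQ1 : prime_ideal Q1 := primeQ _.
have q0 : phi q != 0.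
  rewrite -(rmorph0 phi) inj_eq //; apply: contraNneq Q0q => ->.
  by case: (primeQ ord0) => -[].
have [e [c [t [c0 defq nut]]]] := irredp_valuation irru q0.
move: Q2f; rewrite topQ inE => /Pdiv.Idomain.dvdpP[[a s] /= a0 deff].
have [t' deft'] := phi_surj t; have [a' defa'] := phi_surj (a ^+ e)%:P.
have [b defb] := phi_surj (c%:P * s ^+ e).
have : f ^+ e * t' * a' = b * q.
  apply: phi_inj; rewrite !rmorphM defb deft' defa' /= !rmorphXn /=.
  rewrite mulrAC -exprMn [phi f * _]mulrC [a%:P * _]mul_polyC deff exprMn.
  by rewrite -mulrA -defq -mul_polyC mulrCA mulrA.
have [[Q10 Q11 Q1M] Q1P] := primeQ1.
have Q1bq : b * q \in Q1 by rewrite -[_ * _]addr0; apply: Q1M.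
move=> eqbq; move: Q1bq; rewrite -eqbq => /Q1P /orP[/Q1P /orP[|]|].
- by move/(prime_ideal_exp primeQ1); rewrite (negbTE Q1f).
- by move/sQ1; rewrite topQ inE deft' (negbTE nut).
- move/sQ1; rewrite topQ inE defa' => ua.
  have ae0 : a ^+ e != 0 by rewrite expf_neq0.
  have := dvdp_leq _ ua; rewrite polyC_eq0 ae0 size_polyC ae0 => /(_ isT).
  by have [ugt1 _] := irru; rewrite leqNgt ugt1.
Qed.

End PrincipalPrimes.

(** * Polynomials as univariate polynomials in one of the variables *)

Lemma mpoly_morph_eq (k : fieldType) n (S : comNzRingType) (f g : {rmorphism {mpoly k[n]} -> S}) :
  (forall c, f c%:MP = g c%:MP) -> (forall j, f 'X_j = g 'X_j) -> f =1 g.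
Proof.
move=> fgC fgX; elim/mpolyind=> [|c m p _ _ IHp]; first by rewrite !rmorph0.
rewrite !rmorphD IHp -mul_mpolyC !rmorphM fgC mpolyXE_id !rmorph_prod /=.
by congr (_ * _ + _); apply: eq_bigr => j _; rewrite !rmorphXn fgX.
Qed.

Section OneVariable.
Variables (k : fieldType) (r : nat) (i : 'I_r.+1).
Local Notation R := {mpoly k[r.+1]}.
Local Notation A := {mpoly k[r]}.

Definition uvar_gen (j : 'I_r.+1) : {poly A} :=
  if unlift i j is Some l then ('X_l)%:P else 'X.

Definition uvar : R -> {poly A} := mmap (polyC \o @mpolyC r k) uvar_gen.
(** The image of [avoid] consists of the polynomials in which 'X_i does not occur;
    these are the scalars for the divisibility of univariate polynomials. *)
Definition avoid : A -> R := mmap (@mpolyC r.+1 k) (fun l => 'X_(fintype.lift i l)).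

HB.instance Definition _ := GRing.RMorphism.copy uvar uvar.
HB.instance Definition _ := GRing.RMorphism.copy avoid avoid.

Lemma uvarC c : uvar c%:MP = c%:MP%:P.
Proof. exact: mmapC. Qed.

Lemma uvarX j : uvar 'X_j = uvar_gen j.
Proof. by rewrite /uvar mmapX mmap1U. Qed.

Lemma avoidC c : avoid c%:MP = c%:MP.
Proof. exact: mmapC. Qed.

Lemma avoidX l : avoid 'X_l = 'X_(fintype.lift i l).
Proof. by rewrite /avoid mmapX mmap1U. Qed.

Lemma uvar_avoid c : uvar (avoid c) = c%:P.
Proof.
apply: (mpoly_morph_eq (f := uvar \o avoid) (g := polyC)) => [a|l] /=.
  by rewrite avoidC uvarC.
by rewrite avoidX uvarX /uvar_gen fintype.liftK.
Qed.

Lemma uvar_surj p : exists q, uvar q = p.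
Proof.
elim/poly_ind: p => [|p c [q <-]]; first by exists 0; rewrite rmorph0.
exists (q * 'X_i + avoid c).
by rewrite rmorphD rmorphM /= uvar_avoid uvarX /uvar_gen unlift_none.
Qed.

Lemma uvar_inj : injective uvar.
Proof.
pose g (p : {poly A}) : R := (map_poly avoid p).['X_i].
suff can : cancel uvar g by apply: can_inj can.
apply: (mpoly_morph_eq (f := horner_eval 'X_i \o map_poly avoid \o uvar)
   (g := idfun)) => [c|j] /=.
  by rewrite uvarC map_polyC /= /horner_eval hornerC avoidC.
rewrite uvarX /uvar_gen; case: unliftP => [l ->|->].
  by rewrite map_polyC /= /horner_eval hornerC avoidX.
by rewrite map_polyX /horner_eval hornerX.
Qed.

Lemma msupp_avoid c m : m \in msupp (avoid c) -> m i = 0%N.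
Proof.
elim/mpolyind: c m => [|a m' p _ _ IHp] m; first by rewrite rmorph0 msupp0.
rewrite rmorphD /= => /msuppD_le; rewrite mem_cat => /orP[|/IHp //].
rewrite /avoid mmapZ mul_mpolyC => /msuppZ_le.
rewrite mmapX /mmap1.
suff [m1 -> m1i] : exists2 m1 : 'X_{1..r.+1},
    \prod_(l < r) 'X_(fintype.lift i l) ^+ m' l = 'X_[m1] :> R & m1 i = 0%N.
  by rewrite msuppX inE => /eqP->.
apply: (big_ind (fun p : R => exists2 m1 : 'X_{1..r.+1}, p = 'X_[m1] & m1 i = 0%N)) => [|_ _ [m1 -> m1i] [m2 -> m2i]|l _].
- by exists 0%MM; rewrite ?mpolyX0 ?mnm0E.
- by exists (m1 + m2)%MM; rewrite ?mpolyXD // mnmDE m1i m2i.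
- exists (U_(fintype.lift i l) *+ m' l)%MM; rewrite ?mpolyXn //.
  by rewrite mulmnE mnm1E eq_sym (negbTE (fintype.neq_lift _ _)).
Qed.

Lemma mlead_avoid c : mlead (avoid c) i = 0%N.
Proof.
have [->|c0] := eqVneq (avoid c) 0; first by rewrite mlead0 mnm0E.
exact: msupp_avoid (mlead_supp c0).
Qed.

(** Association of univariate polynomials allows factors in which 'X_i does not
    occur, and these do not affect the exponent of 'X_i in the leading monomial. *)
Lemma uvar_eqp_mlead p q :
  p != 0 -> q != 0 -> uvar p %= uvar q -> mlead p i = mlead q i.
Proof.
move=> p0 q0 /eqpP[[a b] /= /andP[a0 b0] eqab].
have avoid_neq0 c : c != 0 -> avoid c != 0.
  apply: contraNneq => c0; have := uvar_avoid c; rewrite c0 rmorph0 => /esym/eqP.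
  by rewrite polyC_eq0.
have : avoid a * p = avoid b * q.
  by apply: uvar_inj; rewrite !rmorphM /= !uvar_avoid !mul_polyC.
move/(congr1 (fun p : R => mlead p i)).
rewrite (mleadM (avoid_neq0 _ a0) p0) (mleadM (avoid_neq0 _ b0) q0).
by rewrite !mnmDE !mlead_avoid.
Qed.

End OneVariable.

(** * Minors of the middle map of an exact complex *)

Section MatrixPreliminaries.
Variable R : idomainType.

Lemma mulmx_scalar_mx1 p (u : 'cV[R]_p) (q : 'M[R]_1) : u *m q = q 0 0 *: u.
Proof. by rewrite {1}[q]mx11_scalar mul_mx_scalar. Qed.

Lemma lift_columns m p p' (A : 'M[R]_(m, p)) (B : 'M[R]_(p, p')) :
    (forall y : 'cV_p, A *m y = 0 -> exists w : 'cV_p', y = B *m w) ->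
  forall q (Y : 'M_(p, q)), A *m Y = 0 -> exists W : 'M_(p', q), Y = B *m W.
Proof.
move=> ex q Y AY0.
have /fin_all_exists[W defW] l : exists w : 'cV_p', col l Y = B *m w.
  by apply: ex; rewrite colE mulmxA AY0 mul0mx.
exists (\matrix_(i, l) W l i 0); apply/matrixP=> i l.
have /matrixP/(_ i 0) := defW l; rewrite !mxE => ->.
by apply: eq_bigr => j _; rewrite !mxE.
Qed.

Lemma cV_mul_eq0 p m (u : 'cV[R]_p) (x : 'rV[R]_m) :
  u != 0 -> u *m x = 0 -> x = 0.
Proof.
case/cV0Pn=> j uj /matrixP ux0; apply/rowP=> l; rewrite mxE.
by have := ux0 j l; rewrite !mxE big_ord1 => /eqP; rewrite mulf_eq0 (negbTE uj) => /eqP.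
Qed.

(** Putting the j-th unit vector in row i turns a cofactor into a determinant of
    full size, which can then be multiplied with other matrices. *)
Definition set_row n (i j : 'I_n) (A : 'M[R]_n) : 'M[R]_n :=
  \matrix_(p, l) if p == i then (l == j)%:R else A p l.

Lemma det_set_row n i j (A : 'M[R]_n) : \det (set_row i j A) = cofactor A i j.
Proof.
rewrite (expand_det_row _ i) (bigD1 j) //= mxE !eqxx mul1r big1 ?addr0.
  congr (_ * \det _); apply/matrixP=> p l; rewrite !mxE.
  by rewrite eq_sym (negbTE (fintype.neq_lift _ _)).
by move=> l /negbTE nlj; rewrite mxE eqxx nlj mul0r.
Qed.

Lemma set_row_mul n n' i j (A : 'M[R]_n) (W : 'M_(n, n')) p l :
  (set_row i j A *m W) p l = if p == i then W j l else (A *m W) p l.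
Proof.
rewrite !mxE; have [->|npi] := eqVneq p i.
  rewrite (bigD1 j) //= mxE !eqxx mul1r big1 ?addr0 // => q /negbTE nqj.
  by rewrite mxE eqxx nqj mul0r.
by apply: eq_bigr => q _; rewrite mxE (negbTE npi).
Qed.

End MatrixPreliminaries.

Section ExactLength3.
Variables (R : idomainType) (n : nat).
Variables (f : 'rV[R]_n) (D : 'M[R]_n) (v : 'cV[R]_n).
Hypotheses (fD0 : f *m D = 0) (Dv0 : D *m v = 0) (v_neq0 : v != 0).
Hypothesis ex_f : forall y : 'cV_n, f *m y = 0 -> exists w : 'cV_n, y = D *m w.
Hypothesis ex_D : forall z : 'cV_n, D *m z = 0 -> exists q : 'cV_1, z = v *m q.

Lemma exact_det0 : \det D = 0.
Proof.
have := mul_adj_mx D; move/(congr1 (mulmx^~ v)); rewrite -mulmxA Dv0 mulmx0.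
rewrite mul_scalar_mx => /esym/eqP; rewrite scalemx_eq0 (negbTE v_neq0) orbF.
by move/eqP.
Qed.

(** The matrix W is the component in the middle of a contracting homotopy for
    multiplication by f 0 i: its columns lift the Koszul relations between f 0 i
    and the other entries of f. *)
Lemma exact_homotopy i :
  exists W : 'M_n, (f 0 i)%:M - delta_mx i 0 *m f = D *m W.
Proof.
apply: (lift_columns ex_f); rewrite mulmxBr mulmxA -colE mul_mx_scalar.
by rewrite [col i f]mx11_scalar mxE mul_scalar_mx subrr.
Qed.

(** Continuing the homotopy one step further gives a row h with
    f 0 i = h v: multiplication by f 0 i is zero on the cokernel of the transpose
    of v. *)
Lemma exact_sub_last i : exists h : 'rV_n, f 0 i = (h *m v) 0 0.
Proof.
have [W defW] := exact_homotopy i.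
have [h defh] : exists h : 'rV_n, (f 0 i)%:M - W *m D = v *m h.
  apply: (lift_columns ex_D); rewrite mulmxBr mulmxA -defW mulmxBl -mulmxA fD0.
  by rewrite mulmx0 subr0 mul_mx_scalar mul_scalar_mx subrr.
exists h; have := congr1 (mulmx^~ v) defh; rewrite mulmxBl -!mulmxA Dv0 mulmx0 subr0.
rewrite mulmx_scalar_mx1 mul_scalar_mx => /eqP.
by rewrite -subr_eq0 -scalerBl scalemx_eq0 (negbTE v_neq0) orbF subr_eq0 => /eqP.
Qed.

(** The columns of the adjugate lie in the kernel of D, which gives mu.  The bound
    on mu compares two evaluations of one determinant: D with its row i replaced by
    a unit vector, times the homotopy W whose column i, which D sends to 0,
    is replaced by the kernel vector v.  On one side this is a cofactor of D times the determinant of W,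
    on the other an almost scalar matrix with the entry f 0 i on its diagonal. *)
Lemma exact_minors : exists mu : 'rV[R]_n,
  [/\ forall i j, cofactor D i j = v j 0 * mu 0 i,
      forall i j, mu 0 i * f 0 j = mu 0 j * f 0 i
    & forall i, exists de, mu 0 i * de = f 0 i ^+ n.-1].
Proof.
have [mu defmu] : exists mu : 'rV_n, \adj D = v *m mu.
  by apply: (lift_columns ex_D); rewrite mul_mx_adj exact_det0 raddf0.
have muE i j : cofactor D i j = v j 0 * mu 0 i.
  have /matrixP/(_ j i) := defmu; rewrite !mxE => ->.
  by rewrite big_ord1.
have muD0 : mu *m D = 0.
  apply: (cV_mul_eq0 v_neq0).
  by rewrite mulmxA -defmu mul_adj_mx exact_det0 raddf0.
exists mu; split=> // [i j|i].
  have [W defW] := exact_homotopy i.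
  have := congr1 (mulmx mu) defW; rewrite mulmxA muD0 mul0mx mulmxBr mul_mx_scalar.
  rewrite mulmxA -colE => /matrixP/(_ 0 j); rewrite !mxE big_ord1 !mxE => /eqP.
  by rewrite subr_eq0 [f 0 i * _]mulrC => /eqP.
have [W0 defW] := exact_homotopy i.
pose W := \matrix_(p, l) (if l == i then v p 0 else W0 p l).
have [j vj] := cV0Pn _ v_neq0.
exists (\det W); apply: (mulfI vj); rewrite mulrA -muE -det_set_row -det_mulmx.
have DW p l : (D *m W) p l = if l == i then 0 else f 0 i *+ (p == l) - (p == i)%:R * f 0 l.
  have [->|nli] := eqVneq l i.
    have /matrixP/(_ p 0) := Dv0; rewrite !mxE => Dvp; rewrite -[RHS]Dvp.
    by apply: eq_bigr => q _; rewrite mxE eqxx.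
  have /matrixP/(_ p l) := defW; rewrite !mxE big_ord1 !mxE eqxx andbT => ->.
  by apply: eq_bigr => q _; rewrite mxE (negbTE nli).
rewrite (expand_det_col _ i) (bigD1 i) //= big1 ?addr0; last first.
  by move=> p /negbTE npi; rewrite set_row_mul npi DW eqxx mul0r.
rewrite set_row_mul eqxx mxE eqxx; congr (_ * _).
rewrite /cofactor -signr_odd oddD addbb expr0 mul1r -det_scalar; congr (\det _).
apply/matrixP=> p l; rewrite 2!mxE set_row_mul [fintype.lift i p == i]eq_sym.
rewrite (negbTE (fintype.neq_lift _ _)) DW [fintype.lift i l == i]eq_sym.
rewrite (negbTE (fintype.neq_lift _ _)) [fintype.lift i p == i]eq_sym.
by rewrite (negbTE (fintype.neq_lift _ _)) mul0r subr0 (inj_eq (@fintype.lift_inj _ _)) mxE.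
Qed.

End ExactLength3.

(** * Graded maps and degrees *)

Section GradedMaps.
Variables (k : fieldType) (r : nat).

Lemma in_degree_delta n (e : 'I_n -> nat) j :
  in_degree (k := k) (r := r) e (e j) (delta_mx j 0).
Proof.
move=> i; rewrite mxE eqxx andbT; have [->|_] := eqVneq i j.
  by rewrite leqnn subnn dhomog1.
by case: ifP => _; rewrite ?dhomog0.
Qed.

(** Applying the map to the basis vectors shows that a graded map of degree 0 is
    the same as a matrix of homogeneous entries of the expected degrees. *)
Lemma graded_mapP m n (e : 'I_m -> nat) (f : 'I_n -> nat)
    (M : 'M[{mpoly k[r]}]_(m, n)) :
  graded_map e f M <->
  forall i j, if (e i <= f j)%N then M i j \is (f j - e i)%N.-homog else M i j == 0.
Proof.
split=> [gM i j|gM d x gx i].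
  by have := gM _ _ (in_degree_delta f j) i; rewrite -colE mxE.
have Mx j : if (e i <= d)%N then M i j * x j 0 \is (d - e i)%N.-homog
            else M i j * x j 0 == 0.
  have := gM i j; have := gx j.
  case: (leqP (f j) d) => [lefd|_ /eqP->]; last first.
    by move=> _; rewrite mulr0; case: ifP => _; rewrite ?dhomog0.
  case: (leqP (e i) (f j)) => [leef gxj gMij|_ _ /eqP->]; last first.
    by rewrite mul0r; case: ifP => _; rewrite ?dhomog0.
  rewrite (leq_trans leef lefd).
  have -> : (d - e i = (f j - e i) + (d - f j))%N by lia.
  exact: dhomogM.
rewrite mxE; case: ifP Mx => [_ Mx|_ Mx].
  by apply: rpred_sum => j _; apply: Mx.
by rewrite big1 // => j _; apply/eqP.
Qed.

Lemma dhomog_mlead d (p : {mpoly k[r]}) :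
  p != 0 -> p \is d.-homog -> mdeg (mlead p) = d.
Proof. by move=> p0 /dhomogP; apply; apply: mlead_supp. Qed.

Lemma det_dhomog n d (M : 'M[{mpoly k[r]}]_n) :
  (forall i j, M i j \is d.-homog) -> \det M \is (n * d)%N.-homog.
Proof.
move=> hM; rewrite /determinant; apply: rpred_sum => s _.
rewrite -signr_odd mulr_sign.
suff hp : \prod_i M i (s i) \is (n * d)%N.-homog by case: ifP => _; rewrite ?dhomogN.
rewrite -[n in (n * d)%N]card_ord -sum_nat_const.
elim/big_ind2: _ => [|p1 d1 p2 d2 h1 h2|//]; first exact: dhomog1.
exact: dhomogM.
Qed.

Lemma cofactor_dhomog n d (M : 'M[{mpoly k[r]}]_n) i j :
  (forall i j, M i j \is d.-homog) -> cofactor M i j \is (n.-1 * d)%N.-homog.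
Proof.
move=> hM; rewrite /cofactor -signr_odd mulr_sign.
have hdet : \det (row' i (col' j M)) \is (n.-1 * d)%N.-homog.
  by apply: det_dhomog => p q; rewrite !mxE.
by case: ifP => _; rewrite ?dhomogN.
Qed.

Lemma sum_dhomog_le n (h : 'rV[{mpoly k[r]}]_n) (v : 'cV_n) e c :
    (forall j, v j 0 \is c.-homog) -> (h *m v) 0 0 \is e.-homog ->
  (h *m v) 0 0 != 0 -> (c <= e)%N.
Proof.
move=> hv; set p := (h *m v) 0 0 => hp p0; rewrite leqNgt; apply/negP=> ltec.
have /eqP[] : p@_(mlead p) != 0 by rewrite mleadc_eq0.
have defm := dhomog_mlead p0 hp; move: (mlead p) defm => m defm.
rewrite /p mxE raddf_sum big1 //= => j _; apply/eqP.
rewrite mcoeff_eq0; apply/negP.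
move/msuppM_le/allpairsP => [[m1 m2] /= [_ m2v]].
move=> defm12; move: defm; rewrite defm12 mdegD (dhomogP _ _ _ (hv j) _ m2v).
by move=> dege; rewrite -dege ltnNge leq_addl in ltec.
Qed.

End GradedMaps.

(** * Necessity *)

Section Necessity.
Variables (k : fieldType).

(** Otherwise the prime ideal defined by u would contain I, and it has height at
    most 1. *)
Lemma height_no_common_factor r n (I : {pred {mpoly k[r.+1]}})
    (f : 'rV[{mpoly k[r.+1]}]_n) i u :
    height_ge 2 I ->
    (forall p, p \in I -> exists v : 'cV_n, p%:M = f *m v) ->
  irreducible_poly u -> exists j, ~~ (u %| uvar i (f 0 j)).
Proof.
move=> htI genI irru; apply: NNPP => nex.
have uf j : u %| uvar i (f 0 j) by apply: contraT => nuf; case: nex; exists j.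
pose phi : {rmorphism {mpoly k[r.+1]} -> {poly {mpoly k[r]}}} := uvar i.
apply: (@irred_pullback_height _ _ phi (@uvar_inj k r i) (@uvar_surj k r i) u irru).
apply: htI; first exact: irred_pullback_prime.
move=> p /genI[v /matrixP/(_ 0 0)]; rewrite !mxE eqxx mulr1n inE => ->.
rewrite rmorph_sum; apply: (big_ind (fun q => u %| q)) => [|p1 p2|j _].
- exact: dvdp0.
- exact: dvdp_add.
- by rewrite rmorphM; apply/dvdp_mulr/uf.
Qed.

(** Here d is b - a and c is s - b; subtraction-free equations spare the case
    distinctions of truncated subtraction. *)
Lemma essential_Betti_necessary n (a_ b_ : 'I_n -> nat) (a b s : nat) :
    (1 < n)%N -> (forall i, a_ i = a) -> (forall j, b_ j = b) ->
    essential_Betti_sequence k a_ b_ s ->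
  exists c d, [/\ b = (a + d)%N, s = (b + c)%N, (0 < c)%N,
     (n.-1 * d = a + c)%N & (c <= a)%N].
Proof.
move=> n_gt1 ha hb [[//|r] _ [I [_ htI [f [D [v [[gf gD gv] [_ _ mv] [genI exf exD injv]]]]]]]].
have v0 : v != 0.
  apply/eqP => v0; have /matrixP/(_ 0 0)/eqP : (1%:M : 'M[{mpoly k[r.+1]}]_1) = 0.
    by apply: injv; rewrite v0 mul0mx.
  by rewrite !mxE eqxx oner_eq0.
have Dv0 : D *m v = 0 by apply/(exD v); exists 1%:M; rewrite mulmx1.
have fD0 : f *m D = 0.
  apply/matrixP=> i j; have : f *m (D *m (delta_mx j 0 : 'cV_n)) = 0 by apply/(exf _); eexists.
  by rewrite mulmxA -colE => /matrixP/(_ i 0); rewrite !mxE.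
have ex_f y : f *m y = 0 -> exists w : 'cV_n, y = D *m w by move/(exf y).
have ex_D z : D *m z = 0 -> exists q : 'cV_1, z = v *m q by move/(exD z).
have [mu [muE muf muN]] := exact_minors Dv0 v0 ex_f ex_D.
have noF i u : irreducible_poly u -> exists j, ~~ (u %| uvar i (f 0 j)).
  by apply: height_no_common_factor htI _ => p /genI.
have [j0 vj0] := cV0Pn _ v0.
have [i0 fi0] : exists i0, f 0 i0 != 0.
  have irrX : irreducible_poly ('X - 0%:P : {poly {mpoly k[r]}}) by apply: irredp_XsubC.
  have [i nX] := noF ord0 _ irrX; exists i.
  by apply: contraNneq nX => ->; rewrite (rmorph0 (uvar ord0)) dvdp0.
have [de defde] := muN i0.
have mu0 : mu 0 i0 != 0.
  by apply: contra_eq_neq defde => ->; rewrite mul0r eq_sym expf_neq0.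
(* One variable at a time: mu and f are associates up to factors free of 'X_i. *)
have lead_mu : mlead (mu 0 i0) = mlead (f 0 i0).
  apply/mnmP=> i; apply: uvar_eqp_mlead => //.
  apply: (family_eqp (F := fun j => uvar i (f 0 j)) (M := fun j => uvar i (mu 0 j))
           (N := n.-1)) => [u|i1 i2|i1|].
  - exact: noF.
  - by rewrite -[LHS](rmorphM (uvar i)) -[RHS](rmorphM (uvar i)) muf.
  - have [de1 defde1] := muN i1; exists (uvar i de1).
    by rewrite -rmorphM defde1 rmorphXn.
  - by rewrite -(rmorph0 (uvar i)) (inj_eq (@uvar_inj k r i)).
have hf j : f 0 j \is (a)%N.-homog.
  by have /graded_mapP/(_ 0 j) := gf; rewrite ha leq0n subn0.
have hv j : if (b <= s)%N then v j 0 \is (s - b)%N.-homog else v j 0 == 0.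
  by have /graded_mapP/(_ j 0) := gv; rewrite hb.
have lebs : (b <= s)%N by have := hv j0; case: leqP => // _; rewrite (negbTE vj0).
rewrite lebs in hv.
have hD i j : if (a <= b)%N then D i j \is (b - a)%N.-homog else D i j == 0.
  by have /graded_mapP/(_ i j) := gD; rewrite ha hb.
have cof0 : cofactor D i0 j0 != 0 by rewrite muE mulf_neq0.
have leab : (a <= b)%N.
  have := hD; case: leqP => // _ D0.
  (* A zero matrix is homogeneous of degree 0 and of degree 1. *)
  have hcof e : mdeg (mlead (cofactor D i0 j0)) = (n.-1 * e)%N.
    apply: (dhomog_mlead cof0); apply: cofactor_dhomog => i j.
    by rewrite (eqP (D0 i j)) dhomog0.
  by have := etrans (esym (hcof 0)) (hcof 1); rewrite muln0 muln1; lia.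
rewrite leab in hD.
have deg : (n.-1 * (b - a) = a + (s - b))%N.
  have := cofactor_dhomog i0 j0 hD; move/(dhomog_mlead cof0) => <-.
  rewrite muE mleadM // mdegD lead_mu (dhomog_mlead fi0 (hf _)).
  by rewrite (dhomog_mlead vj0 (hv _)) addnC.
exists (s - b)%N, (b - a)%N; split=> //.
- by rewrite subnKC.
- by rewrite subnKC.
- have : mlead (v j0 0) != 0%MM.
    apply: contraTneq vj0 => lead0; rewrite -mleadc_eq0 lead0.
    by rewrite mv eqxx.
  by rewrite -mdeg_eq0 (dhomog_mlead vj0 (hv _)) lt0n.
- have [h defh] := exact_sub_last fD0 Dv0 v0 ex_f ex_D i0.
  by apply: (sum_dhomog_le (h := h) hv); rewrite -defh.
Qed.

End Necessity.

(** * An exactness criterion for Hessenberg matrices *)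

(** Only the shape above the diagonal matters: with a nonvanishing superdiagonal,
    each kernel vector is determined by its first entry and each left kernel vector
    by its last one. *)
Section Hessenberg.
Variables (R : idomainType) (N : nat).
Variables (D : 'M[R]_N.+1).
Hypothesis hess : forall i j : 'I_N.+1, (i.+1 < j)%N -> D i j = 0.
Hypothesis sup_neq0 : forall i j : 'I_N.+1, j = i.+1 :> nat -> D i j != 0.

Lemma hess_ker0 (z : 'cV_N.+1) : D *m z = 0 -> z ord0 0 = 0 -> z = 0.
Proof.
move=> Dz0 z0; apply/colP=> i; rewrite [RHS]mxE.
have [p] := ubnP (i : nat); elim: p i => // p IHp [[|i] ltiN] lep.
  by rewrite -[RHS]z0; congr (z _ _); apply: val_inj.
pose i0 : 'I_N.+1 := Ordinal (ltnW ltiN).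
have /matrixP/(_ i0 0) := Dz0; rewrite !mxE (bigD1 (Ordinal ltiN)) //= big1 ?addr0.
  by move/eqP; rewrite mulf_eq0 (negbTE (sup_neq0 _)) //= => /eqP.
move=> l nli; have [leli|ltil] := leqP l i; first by rewrite IHp ?mulr0 //= (leq_ltn_trans leli).
rewrite hess ?mul0r //=; rewrite ltn_neqAle ltil andbT.
by apply: contraNneq nli => eqil; apply/eqP/val_inj.
Qed.

Lemma hess_coker0 (x : 'rV_N.+1) : x *m D = 0 -> x 0 ord_max = 0 -> x = 0.
Proof.
move=> xD0 xN; apply/rowP=> i; rewrite [RHS]mxE.
have [p] := ubnP (N - i)%N; elim: p i => // p IHp i lep.
have [ltiN|leNi] := ltnP i N; last first.
  rewrite -[RHS]xN; congr (x _ _); apply: val_inj; apply/eqP.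
  by rewrite /= eqn_leq leNi -ltnS ltn_ord.
pose i1 : 'I_N.+1 := Ordinal (ltiN : i.+1 < N.+1)%N.
have /matrixP/(_ 0 i1) := xD0; rewrite !mxE (bigD1 i) //= big1 ?addr0.
  by move/eqP; rewrite mulf_eq0 (negbTE (sup_neq0 _)) //= orbF => /eqP.
move=> l nli; have [ltil|leli] := ltnP i l.
  by rewrite IHp ?mul0r //; lia.
rewrite hess ?mulr0 //= ltnS ltn_neqAle leli andbT.
by apply: contraNneq nli => eqil; apply/eqP/val_inj.
Qed.

Variables (f : 'rV[R]_N.+1) (v : 'cV[R]_N.+1).
Hypotheses (fD0 : f *m D = 0) (Dv0 : D *m v = 0).
Hypotheses (v0 : v ord0 0 != 0) (fN : f 0 ord_max != 0).

Lemma hess_ker (z : 'cV_N.+1) i : D *m z = 0 -> v ord0 0 * z i 0 = z ord0 0 * v i 0.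
Proof.
move=> Dz0; have : v ord0 0 *: z - z ord0 0 *: v = 0.
  apply: hess_ker0; last by rewrite !mxE mulrC subrr.
  by rewrite mulmxBr -!scalemxAr Dz0 Dv0 !scaler0 subrr.
by move/matrixP/(_ i 0)/eqP; rewrite !mxE subr_eq0 => /eqP.
Qed.

Lemma hess_coker (x : 'rV_N.+1) i : x *m D = 0 -> f 0 ord_max * x 0 i = x 0 ord_max * f 0 i.
Proof.
move=> xD0; have : f 0 ord_max *: x - x 0 ord_max *: f = 0.
  apply: hess_coker0; last by rewrite !mxE mulrC subrr.
  by rewrite mulmxBl -!scalemxAl xD0 fD0 !scaler0 subrr.
by move/matrixP/(_ 0 i)/eqP; rewrite !mxE subr_eq0 => /eqP.
Qed.

Hypothesis prod_sup :
  \prod_(i < N) D (fintype.lift ord_max i) (fintype.lift ord0 i) = v ord0 0 * f 0 ord_max.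

(** Every column of the adjugate is proportional to v and every row to f, so one
    corner entry fixes it; that corner is the product of the superdiagonal, the
    remaining submatrix being triangular. *)
Lemma hess_adj i j : \adj D i j = (-1) ^+ N * (v i 0 * f 0 j).
Proof.
have det0D : \det D = 0.
  have := mul_adj_mx D; move/(congr1 (mulmx^~ v)); rewrite -mulmxA Dv0 mulmx0.
  rewrite mul_scalar_mx => /esym/matrixP/(_ ord0 0)/eqP; rewrite !mxE mulf_eq0.
  by rewrite (negbTE v0) orbF => /eqP.
have adj0N : \adj D ord0 ord_max = (-1) ^+ N * (v ord0 0 * f 0 ord_max).
  rewrite mxE /cofactor addn0 det_trig; last first.
    apply/is_trig_mxP=> p q ltpq; rewrite !mxE hess //.
    by rewrite lift_max lift0 !ltnS.
  by rewrite -prod_sup; congr (_ * _); apply: eq_bigr => l _; rewrite !mxE.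
have row_adj : f 0 ord_max * \adj D ord0 j = \adj D ord0 ord_max * f 0 j.
  have := @hess_coker (row ord0 (\adj D)) j; rewrite !mxE; apply.
  by rewrite -row_mul mul_adj_mx det0D raddf0 row0.
have col_adj : v ord0 0 * \adj D i j = \adj D ord0 j * v i 0.
  have := @hess_ker (col j (\adj D)) i; rewrite !mxE; apply.
  by rewrite colE mulmxA mul_mx_adj det0D raddf0 mul0mx.
apply: (mulfI (mulf_neq0 v0 fN)).
rewrite mulrAC col_adj mulrAC -[_ * _ * v _ _]mulrC [_ * f 0 ord_max]mulrC row_adj adj0N.
by ring.
Qed.

End Hessenberg.

(** A case of the Buchsbaum-Eisenbud criterion: f has grade at least 2, the minors
    of D are, up to a common unit, the products of the entries of f and v, and the entries of v contain a
    regular sequence of length 3. *)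
Section ExactnessCriterion.
Variables (R : idomainType) (n : nat).
Variables (f : 'rV[R]_n) (D : 'M[R]_n) (v : 'cV[R]_n) (e : R).
Hypotheses (fD0 : f *m D = 0) (Dv0 : D *m v = 0).
Hypothesis e2 : e * e = 1.
Hypothesis adjE : forall i j, \adj D i j = e * (v i 0 * f 0 j).
Hypothesis kerD : forall z : 'cV_n, D *m z = 0 -> exists q, z = q *: v.
Hypothesis grade_f : forall x : 'I_n -> R,
  (forall i j, x i * f 0 j = x j * f 0 i) -> exists q, forall i, x i = f 0 i * q.
Hypothesis f_neq0 : exists i, f 0 i != 0.

(** Cramer's rule solves the equations other than the i-th one with the j-th
    unknown set to 0; the i-th equation follows from the relation f between the
    rows of D. *)
Lemma cramer_lift (y : 'cV_n) i j :
  f *m y = 0 -> exists2 z : 'cV_n, D *m z = (v j 0 * f 0 i) *: y & z j 0 = 0.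
Proof.
move=> fy0; have [fi0|fi_neq0] := eqVneq (f 0 i) 0.
  by exists 0; rewrite ?mulmx0 ?mxE // fi0 mulr0 scale0r.
pose y1 : 'cV_n := \col_p (if p == i then 0 else y p 0).
pose z := e *: (\adj (set_row i j D) *m y1).
have Sz : set_row i j D *m z = (v j 0 * f 0 i) *: y1.
  rewrite -scalemxAr mulmxA mul_mx_adj mul_scalar_mx scalerA det_set_row.
  have -> : cofactor D i j = \adj D j i by rewrite mxE.
  by rewrite adjE [e * (e * _)]mulrA e2 mul1r.
clearbody z; have Szp p : (set_row i j D *m z) p 0 = if p == i then z j 0 else (D *m z) p 0.
  exact: set_row_mul.
have zj : z j 0 = 0.
  by have := Szp i; rewrite eqxx Sz !mxE eqxx mulr0.
exists z => //.
have Dzp p : p != i -> (D *m z) p 0 = v j 0 * f 0 i * y p 0.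
  by move=> npi; have := Szp p; rewrite (negbTE npi) Sz !mxE (negbTE npi).
have fDz : f *m (D *m z - (v j 0 * f 0 i) *: y) = 0.
  by rewrite mulmxBr mulmxA fD0 mul0mx -scalemxAr fy0 scaler0 subr0.
apply/eqP; rewrite -subr_eq0; apply/eqP/colP=> p; rewrite [RHS]mxE.
have sub0 q : q != i -> (D *m z - (v j 0 * f 0 i) *: y) q 0 = 0.
  by move=> nqi; have := Dzp q nqi; rewrite !mxE => ->; rewrite subrr.
have [->|/sub0//] := eqVneq p i.
have /matrixP/(_ 0 0) := fDz; rewrite mxE (bigD1 i) //= big1 ?addr0.
  by rewrite [RHS]mxE => /eqP; rewrite mulf_eq0 (negbTE fi_neq0) => /eqP.
by move=> q nqi; rewrite sub0 ?mulr0.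
Qed.

(** The normalization z j 0 = 0 makes the solutions for different i proportional
    to the entries of f, and grade 2 allows to divide by these entries. *)
Lemma grade2_lift (y : 'cV_n) j :
  f *m y = 0 -> v j 0 != 0 -> exists z : 'cV_n, D *m z = v j 0 *: y.
Proof.
move=> fy0 vj; have /fin_all_exists[z hz] i : exists z : 'cV_n,
    D *m z = (v j 0 * f 0 i) *: y /\ z j 0 = 0.
  by have [z] := cramer_lift i j fy0; exists z.
have zz i l : f 0 l *: z i = f 0 i *: z l.
  have [Dzi zij] := hz i; have [Dzl zlj] := hz l.
  have [q defq] : exists q, f 0 l *: z i - f 0 i *: z l = q *: v.
    apply: kerD; rewrite mulmxBr -!scalemxAr Dzi Dzl !scalerA.
    by rewrite (_ : f 0 l * _ = f 0 i * (v j 0 * f 0 l)) ?subrr //; ring.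
  have /matrixP/(_ j 0)/esym/eqP := defq.
  rewrite !mxE zij zlj !mulr0 subrr mulf_eq0 (negbTE vj) orbF => /eqP q0.
  by apply/eqP; rewrite -subr_eq0 defq q0 scale0r.
have /fin_all_exists[w hw] p : exists q, forall i, z i p 0 = f 0 i * q.
  apply: grade_f => i l; have /matrixP/(_ p 0) := zz i l.
  by rewrite !mxE mulrC => ->; rewrite mulrC.
have [i fi] := f_neq0; exists (\col_p w p).
have zE : z i = f 0 i *: \col_p w p by apply/colP=> p; rewrite !mxE hw.
have [Dzi _] := hz i; rewrite zE -scalemxAr in Dzi.
apply/colP=> p; apply: (mulfI fi).
move/matrixP/(_ p 0): Dzi; rewrite mxE => ->; rewrite mxE [in RHS]mxE.
by rewrite mulrA [f 0 i * _]mulrC.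
Qed.

Variables (j1 j2 j3 : 'I_n).
Hypotheses (v1 : v j1 0 != 0) (v2 : v j2 0 != 0) (v3 : v j3 0 != 0).
Hypothesis reg2 : forall x y, v j2 0 * y = v j1 0 * x -> exists q, y = v j1 0 * q.
Hypothesis reg3 : forall q x y, v j3 0 * q = v j1 0 * x + v j2 0 * y ->
  exists x' y', q = v j1 0 * x' + v j2 0 * y'.

(** The solutions z1, z2, z3 for the three entries of v differ by multiples
    q12, q13, q23 of v, which satisfy a cocycle relation; regularity of the sequence
    makes q12 a coboundary, and after correcting z1 by it, z1 is divisible. *)
Lemma exact_of_grades (y : 'cV_n) : f *m y = 0 -> exists z : 'cV_n, y = D *m z.
Proof.
move=> fy0.
have [z1 Dz1] := grade2_lift fy0 v1; have [z2 Dz2] := grade2_lift fy0 v2.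
have [z3 Dz3] := grade2_lift fy0 v3.
have cross i j zi zj : D *m zi = v i 0 *: y -> D *m zj = v j 0 *: y ->
    exists q, v j 0 *: zi - v i 0 *: zj = q *: v.
  move=> Di Dj; apply: kerD; rewrite mulmxBr -!scalemxAr Di Dj !scalerA.
  by rewrite mulrC subrr.
have [q12 e12] := cross _ _ _ _ Dz1 Dz2; have [q13 e13] := cross _ _ _ _ Dz1 Dz3.
have [q23 e23] := cross _ _ _ _ Dz2 Dz3.
have [x [x' defq]] : exists x y, q12 = v j1 0 * x + v j2 0 * y.
  apply: (@reg3 _ (- q23) q13); apply: (mulIf v1).
  have /matrixP/(_ j1 0) := e12; have /matrixP/(_ j1 0) := e13.
  have /matrixP/(_ j1 0) := e23; rewrite !mxE => h23 h13 h12.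
  rewrite mulrDl mulrN mulNr -!mulrA -h12 -h13 -h23; ring.
have /fin_all_exists[w hw] p : exists q, (z1 p 0 - x' * v p 0) = v j1 0 * q.
  have /matrixP/(_ p 0) := e12; rewrite !mxE defq => h12.
  apply: (@reg2 (z2 p 0 + x * v p 0)).
  by move/eqP: h12; rewrite subr_eq => /eqP h12; rewrite mulrBr h12; ring.
exists (\col_p w p); have z1E : z1 - x' *: v = v j1 0 *: \col_p w p.
  by apply/colP=> p; rewrite !mxE hw.
have := congr1 (mulmx D) z1E; rewrite mulmxBr -!scalemxAr Dv0 scaler0 subr0 Dz1.
by move/matrixP=> eqy; apply/colP=> p; have := eqy p 0; rewrite 2!mxE => /(mulfI v1).
Qed.

End ExactnessCriterion.

(** * The tridiagonal complex *)

(** Here d = t + h, m = m' + 1 and c = t + (m - 1) d; the matrices have size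
    2m + 1 + q, with q the size of the appended block. *)
Section Construction.
Variables (R : comNzRingType) (x y z w : R) (m' t h q : nat).
Local Notation d := (t + h)%N.
Local Notation m := m'.+1.
Local Notation c := (t + m' * d)%N.

(** Rows i and 2m - i have degree [rowdeg i] up to a factor of degree [rowgap i];
    [contdeg i] is the degree of the i-th continuant, the sum of the degrees of
    the first i rows. *)
Definition rowdeg (i : nat) := if i is 0 then t else d.
Definition contdeg (i : nat) := if i is i'.+1 then (t + i' * d)%N else 0%N.
Definition rowgap (i : nat) := if i is 0 then h else 0%N.

(** Up to sign, a leading principal minor of the matrix after division of its first
    row by x ^+ h.  Only the products of opposite off-diagonal entries enter, and
    these are the same read from either end of the tridiagonal part. *)
Fixpoint continuant (n : nat) : R :=
  if n is n'.+1 then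
    if n' is n''.+1 then
      y ^+ d * continuant n' - w ^+ rowgap n'' * (x * z) ^+ rowdeg n'' * continuant n''
    else y ^+ t
  else 1.

(** An off-diagonal entry joining row i to its neighbour of degree d, where w makes
    up for the difference of the degrees. *)
Definition padpow (u : R) i := w ^+ rowgap i * u ^+ rowdeg i.

(** Superdiagonal, diagonal and subdiagonal of D: the rows above the middle row m,
    the middle row, the rows up to 2m, which mirror the first ones with x and z
    exchanged, and the appended bidiagonal block.  The sign in the middle row makes
    the upper and the lower half compatible. *)
Definition d2_super i :=
  if (i < m)%N then x ^+ d else if (i == m)%N then - padpow x m'
  else if (i < m.*2)%N then padpow x (m.*2 - i).-1 else x ^+ d.
Definition d2_diag i :=
  if (i < m)%N then - (x ^+ rowgap i * y ^+ rowdeg i) else if (i == m)%N then 0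
  else if (i <= m.*2)%N then - (z ^+ rowgap (m.*2 - i) * y ^+ rowdeg (m.*2 - i))
  else - y ^+ d.
Definition d2_sub i :=
  if i is i'.+1 then
    if (i <= m)%N then padpow z i' else if (i <= m.*2)%N then z ^+ d else 0
  else 0.

(** Solved from the top for i <= m and from the bottom for m <= i <= 2m; both
    recursions give the continuant at the middle index. *)
Definition d3_entry i :=
  if (i <= m)%N then x ^+ (c - contdeg i) * continuant i
  else if (i <= m.*2)%N then z ^+ (c - contdeg (m.*2 - i)) * continuant (m.*2 - i) else 0.

Definition d1_entry i :=
  if (i <= m)%N then
    w ^+ rowgap i * x ^+ (h - rowgap i) * z ^+ (h + (c - contdeg i)) * continuant i * y ^+ (q * d)
  else if (i <= m.*2)%N then
    - (w ^+ rowgap (m.*2 - i) * z ^+ (h - rowgap (m.*2 - i)) * x ^+ (h + (c - contdeg (m.*2 - i)))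
       * continuant (m.*2 - i) * y ^+ (q * d))
  else - (w ^+ h * x ^+ (h + c + (i - m.*2) * d) * y ^+ ((q - (i - m.*2)) * d)).

Lemma contdegS i : contdeg i.+1 = (contdeg i + rowdeg i)%N.
Proof. by case: i => [|i] /=; rewrite ?mul0n ?addn0 // mulSn; lia. Qed.

Lemma leq_contdeg i : (i <= m)%N -> (contdeg i <= c)%N.
Proof. by case: i => //= i lei; rewrite leq_add2l leq_mul2r -ltnS lei orbT. Qed.

Lemma contdegSS i : (i.+2 <= m)%N ->
  (c - contdeg i.+1 = c - contdeg i.+2 + d)%N /\ (c - contdeg i = c - contdeg i.+2 + d + rowdeg i)%N.
Proof. by move=> lei; have := leq_contdeg lei; rewrite !contdegS /=; lia. Qed.

Lemma rowdeg_gap i : (rowdeg i + rowgap i = d)%N.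
Proof. by case: i => [|i] /=; rewrite ?addn0. Qed.

Lemma rowgap_le i : (rowgap i <= h)%N. Proof. by case: i. Qed.

Lemma expr_rowdeg u i : u ^+ d = u ^+ rowgap i * u ^+ rowdeg i :> R.
Proof. by rewrite -(rowdeg_gap i) exprD mulrC. Qed.

Lemma expr_rowgap u i : u ^+ h = u ^+ rowgap i * u ^+ (h - rowgap i) :> R.
Proof. by rewrite -exprD subnKC ?rowgap_le. Qed.

Lemma d2_super_up i : (i < m)%N -> d2_super i = x ^+ d.
Proof. by rewrite /d2_super => ->. Qed.

Lemma d2_super_lo i : (i.+1 < m)%N -> d2_super (m.*2 - i.+1) = padpow x i.
Proof.
move=> lei; rewrite /d2_super.
have -> : (m.*2 - i.+1 < m)%N = false by lia.
have -> : (m.*2 - i.+1 == m)%N = false by lia.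
have -> : (m.*2 - i.+1 < m.*2)%N by lia.
by congr padpow; lia.
Qed.

Lemma d3_entry_up i : (i <= m)%N -> d3_entry i = x ^+ (c - contdeg i) * continuant i.
Proof. by rewrite /d3_entry => ->. Qed.

Lemma d3_entry_lo i : (i <= m)%N -> d3_entry (m.*2 - i) = z ^+ (c - contdeg i) * continuant i.
Proof.
rewrite /d3_entry => lei; case: ifP => [le2|_].
  have -> : i = m by lia.
  have -> : (m.*2 - m = m)%N by lia.
  by rewrite subnn !expr0.
by rewrite ifT ?leq_subr // subKn //; lia.
Qed.

Lemma d3_entry_tail i : (m.*2 < i)%N -> d3_entry i = 0.
Proof.
move=> lti; rewrite /d3_entry; have -> : (i <= m)%N = false by lia.
by rewrite leqNgt lti.
Qed.

Lemma d2_sub_tail i : (m.*2 < i)%N -> d2_sub i = 0.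
Proof.
case: i => // i lti; rewrite /d2_sub; have -> : (i.+1 <= m)%N = false by lia.
by rewrite leqNgt lti.
Qed.

Lemma d1_entry_up i : (i <= m)%N ->
  d1_entry i = w ^+ rowgap i * x ^+ (h - rowgap i) * z ^+ (h + (c - contdeg i)) * continuant i * y ^+ (q * d).
Proof. by rewrite /d1_entry => ->. Qed.

Lemma d1_entry_lo i : (i < m)%N -> d1_entry (m.*2 - i) =
  - (w ^+ rowgap i * z ^+ (h - rowgap i) * x ^+ (h + (c - contdeg i)) * continuant i * y ^+ (q * d)).
Proof. by rewrite /d1_entry => lei; rewrite ifF ?ifT ?leq_subr // ?subKn //; lia. Qed.

Lemma d1_entry_tail i : d1_entry (m.*2 + i) =
  - (w ^+ h * x ^+ (h + c + i * d) * y ^+ ((q - i) * d)).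
Proof.
case: i => [|i].
  by rewrite addn0 -[m.*2 in LHS]subn0 d1_entry_lo //= subnn expr0 !subn0 mul0n addn0 !mulr1.
rewrite /d1_entry; have -> : (m.*2 + i.+1 <= m)%N = false by lia.
by rewrite -[X in (_ <= X)%N]addn0 leq_add2l ltn0 addKn.

Qed.

Lemma continuant_rec i : continuant i.+2 = y ^+ d * continuant i.+1 - w ^+ rowgap i * (x * z) ^+ rowdeg i * continuant i.
Proof. by []. Qed.

Lemma d2_d3_row i :
  (if i is i'.+1 then d2_sub i * d3_entry i' else 0) + d2_diag i * d3_entry i + d2_super i * d3_entry i.+1 = 0.
Proof.
have [ltim|] := ltnP i m.
  case: i ltim => [|i] ltim.
    rewrite d2_super_up // !d3_entry_up // /d2_diag ltim /= subn0 add0r mulr1.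
    have -> : (t + m' * d - (t + 0 * d) = m' * d)%N by lia.
    by rewrite !exprD; ring.
  rewrite d2_super_up // /d2_diag ltim !d3_entry_up; try lia.
  rewrite /d2_sub (ltnW ltim) continuant_rec /padpow; have [-> ->] := contdegSS ltim.
  by rewrite exprMn /= !exprD; ring.
rewrite leq_eqVlt => /orP[/eqP<-|ltmi].
  have e1 : m.+1 = (m.*2 - m')%N by lia.
  rewrite /d2_sub leqnn /d2_diag ltnn eqxx mul0r addr0 /d2_super ltnn eqxx e1 d3_entry_lo // d3_entry_up //.
  have -> : (c - contdeg m' = rowdeg m')%N by have := contdegS m'; rewrite /=; lia.
  by rewrite /padpow; ring.
have [lei2|lt2i] := leqP i m.*2; last first.
  case: i ltmi lt2i => // i ltmi lt2i.
  rewrite [d3_entry i.+2]d3_entry_tail ?(@d3_entry_tail i.+1) //; last exact: ltnW.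
  rewrite /d2_sub leqNgt ltmi; have -> : (i.+1 <= m.*2)%N = false by lia.
  by rewrite !(mul0r, mulr0, addr0).
have [j ltjm ->] : exists2 j, (j < m)%N & i = (m.*2 - j)%N.
  by exists (m.*2 - i)%N; lia.
have -> : (if (m.*2 - j)%N is i'.+1 then d2_sub (m.*2 - j) * d3_entry i' else 0)
        = z ^+ d * d3_entry (m.*2 - j.+1).
  have -> : (m.*2 - j = (m.*2 - j.+1).+1)%N by lia.
  rewrite /d2_sub; have -> : ((m.*2 - j.+1).+1 <= m)%N = false by lia.
  by have -> : ((m.*2 - j.+1).+1 <= m.*2)%N by lia.
have -> : d2_diag (m.*2 - j) = - (z ^+ rowgap j * y ^+ rowdeg j).
  rewrite /d2_diag; have -> : (m.*2 - j < m)%N = false by lia.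
  have -> : (m.*2 - j == m)%N = false by lia.
  by rewrite leq_subr subKn //; lia.
case: j ltjm => [|j] ltjm.
  rewrite !d3_entry_lo // subn0 [d3_entry m.*2.+1](_ : _ = 0); last first.
    rewrite /d3_entry; have -> : (m.*2.+1 <= m)%N = false by lia.
    by rewrite ltnn.
  have -> : (t + m' * d - contdeg 1 = m' * d)%N by rewrite /=; lia.
  by rewrite /= subn0 !exprD; ring.
have -> : (m.*2 - j.+1).+1 = (m.*2 - j)%N by lia.
rewrite d2_super_lo // !d3_entry_lo //; try lia.
by rewrite /padpow continuant_rec; have [-> ->] := contdegSS ltjm; rewrite exprMn /= !exprD; ring.
Qed.

(** The sign of the middle row is absorbed by the change of sign of [d1_entry] at
    the middle index, so that a single formula covers both. *)
Lemma d2_super_d1_lo i : (i < m)%N ->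
  d2_super (m.*2 - i.+1) * d1_entry (m.*2 - i.+1) = - (padpow x i *
    (z ^+ h * x ^+ (h + (c - contdeg i.+1)) * continuant i.+1 * y ^+ (q * d))).
Proof.
rewrite leq_eqVlt => /orP[/eqP[eqi]|ltim]; last first.
  by rewrite d2_super_lo // d1_entry_lo // /rowgap subn0 mul1r mulrN.
rewrite eqi; have -> : (m.*2 - m = m)%N by lia.
rewrite /d2_super ltnn eqxx d1_entry_up // [rowgap m]/= subn0 [contdeg m]/= subnn !addn0.
by ring.
Qed.

Lemma d1_d2_col j : (j <= m.*2 + q)%N ->
  (if j is j'.+1 then d2_super j' * d1_entry j' else 0) + d2_diag j * d1_entry j + d2_sub j.+1 * d1_entry j.+1 = 0.
Proof.
move=> lejN; have [ltjm|] := ltnP j m.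
  case: j ltjm {lejN} => [|i] ltim.
    rewrite /d2_diag ltim /d2_sub /= /padpow !d1_entry_up //= !subn0 !subnn.
    have -> : (t + m' * d - (t + 0 * d) = m' * d)%N by lia.
    by rewrite !exprD; ring.
  rewrite d2_super_up 1?ltnW // /d2_diag ltim /d2_sub ltim !d1_entry_up; try lia.
  rewrite continuant_rec /padpow; have [-> ->] := contdegSS ltim.
  by rewrite (expr_rowdeg x i) exprMn /= subn0 (expr_rowgap x i) !exprD; ring.
rewrite leq_eqVlt => /orP[/eqP<-|ltmj].
  rewrite d2_super_up // /d2_diag ltnn eqxx mul0r addr0 /d2_sub.
  have -> : (m.+1 <= m)%N = false by lia.
  have -> : (m.+1 <= m.*2)%N by lia.
  have -> : m.+1 = (m.*2 - m')%N by lia.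
  rewrite d1_entry_lo // d1_entry_up //.
  have -> : (c - contdeg m' = rowdeg m')%N by have := contdegS m'; rewrite /=; lia.
  rewrite !(exprD _ h) !(expr_rowdeg _ m') !(expr_rowgap _ m'); ring.
have [lej2|lt2j] := leqP j m.*2.
  have [i ltim ->] : exists2 i, (i < m)%N & j = (m.*2 - i)%N.
    by exists (m.*2 - j)%N; lia.
  have -> : (if (m.*2 - i)%N is j'.+1 then d2_super j' * d1_entry j' else 0)
          = d2_super (m.*2 - i.+1) * d1_entry (m.*2 - i.+1).
    by have -> : (m.*2 - i = (m.*2 - i.+1).+1)%N by lia.
  have -> : d2_diag (m.*2 - i) = - (z ^+ rowgap i * y ^+ rowdeg i).
    rewrite /d2_diag; have -> : (m.*2 - i < m)%N = false by lia.
    have -> : (m.*2 - i == m)%N = false by lia.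
    by rewrite leq_subr subKn //; lia.
  rewrite d2_super_d1_lo // d1_entry_lo // /d2_sub.
  have -> : ((m.*2 - i).+1 <= m)%N = false by lia.
  case: i ltim => [|i] ltim.
    rewrite subn0 ltnn mul0r addr0 /padpow /= !subn0 !subnn.
    have -> : (t + m' * d - (t + 0 * d) = m' * d)%N by lia.
    by rewrite !exprD; ring.
  have -> : (m.*2 - i.+1).+1 = (m.*2 - i)%N by lia.
  rewrite leq_subr d1_entry_lo; last by lia.
  rewrite continuant_rec /padpow; have [-> ->] := contdegSS ltim.
  by rewrite (expr_rowdeg z i) exprMn /= subn0 (expr_rowgap z i) !exprD; ring.
case: j lejN lt2j ltmj => // j lejN lt2j ltmj.
have [i def_j] : exists i, j = (m.*2 + i)%N by exists (j - m.*2)%N; lia.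
have ltiq : (i < q)%N by move: lejN; rewrite def_j; lia.
have -> : d2_super j = x ^+ d.
  rewrite /d2_super; have -> : (j < m)%N = false by lia.
  have -> : (j == m)%N = false by lia.
  by rewrite def_j ltnNge leq_addr.
have -> : d2_diag j.+1 = - y ^+ d.
  rewrite /d2_diag; have -> : (j.+1 < m)%N = false by lia.
  have -> : (j.+1 == m)%N = false by lia.
  by rewrite leqNgt lt2j.
have -> : d2_sub j.+2 = 0.
  rewrite /d2_sub; have -> : (j.+2 <= m)%N = false by lia.
  by have -> : (j.+2 <= m.*2)%N = false by lia.
rewrite mul0r addr0 def_j -addnS !d1_entry_tail.
have -> : (q - i = (q - i.+1).+1)%N by lia.
by rewrite !mulSn !exprD; ring.
Qed.

End Construction.

Section Tridiagonal.
Variables (R : comNzRingType) (n : nat).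

Lemma sum_nat_delta (F : nat -> R) a :
  \sum_(j < n) (j == a :> nat)%:R * F j = if (a < n)%N then F a else 0.
Proof.
case: ltnP => [ltan|lena].
  rewrite (bigD1 (Ordinal ltan)) //= eqxx mul1r big1 ?addr0 // => j nja.
  by rewrite (_ : (j == a :> nat) = false) ?mul0r //; apply: contraNF nja => /eqP eqja; apply/eqP/val_inj.
rewrite big1 // => j _; rewrite (_ : (j == a :> nat) = false) ?mul0r //.
by apply/negbTE; rewrite neq_ltn (leq_trans (ltn_ord j)).
Qed.

Variables lo di up : nat -> R.

Definition tridiag : 'M[R]_n := \matrix_(i, j)
  ((j == i.+1 :> nat)%:R * up i + (j == i :> nat)%:R * di i
     + (j.+1 == i :> nat)%:R * lo i).

Lemma tridiag_row (g : nat -> R) (i : 'I_n) :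
  \sum_(j < n) tridiag i j * g j =
    (if i : nat is i'.+1 then lo i * g i' else 0) + di i * g i
      + (if (i.+1 < n)%N then up i * g i.+1 else 0).
Proof.
transitivity (\sum_(j < n) (j == i.+1 :> nat)%:R * (up i * g j)
   + \sum_(j < n) (j == i :> nat)%:R * (di i * g j)
   + \sum_(j < n) (j.+1 == i :> nat)%:R * (lo i * g j)).
  by rewrite -!big_split; apply: eq_bigr => j _; rewrite mxE /=; ring.
rewrite (sum_nat_delta (fun j => up i * g j)) (sum_nat_delta (fun j => di i * g j)) ltn_ord.
rewrite addrC [X in _ + X]addrC addrA; congr (_ + _ + _).
case: i => -[|i] lti /=.
  by rewrite big1 // => j _; rewrite mul0r.
under eq_bigr do rewrite eqSS.
by rewrite (sum_nat_delta (fun j => lo i.+1 * g j)) (ltnW lti).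
Qed.

Lemma tridiag_col (g : nat -> R) (j : 'I_n) :
  \sum_(i < n) g i * tridiag i j =
    (if j : nat is j'.+1 then up j' * g j' else 0) + di j * g j
      + (if (j.+1 < n)%N then lo j.+1 * g j.+1 else 0).
Proof.
transitivity (\sum_(i < n) (i.+1 == j :> nat)%:R * (up i * g i)
   + \sum_(i < n) (i == j :> nat)%:R * (di i * g i)
   + \sum_(i < n) (i == j.+1 :> nat)%:R * (lo i * g i)).
  rewrite -!big_split; apply: eq_bigr => i _; rewrite mxE /=.
  by rewrite [j == i.+1 :> nat]eq_sym [j == i :> nat]eq_sym [j.+1 == i :> nat]eq_sym; ring.
rewrite (sum_nat_delta (fun j => di j * g j)) (sum_nat_delta (fun j => lo j * g j)) ltn_ord.
congr (_ + _ + _).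
case: j => -[|j] ltj /=.
  by rewrite big1 // => i _; rewrite mul0r.
under eq_bigr do rewrite eqSS.
by rewrite (sum_nat_delta (fun i => up i * g i)) (ltnW ltj).
Qed.

End Tridiagonal.

Section ConstructionMatrices.
Variables (R : comNzRingType) (x y z w : R) (m' t h q : nat).
Local Notation d := (t + h)%N.
Local Notation m := m'.+1.
Local Notation c := (t + m' * d)%N.
Local Notation N := (m.*2 + q)%N.
Local Notation d2_super := (d2_super x w m' t h).
Local Notation d2_diag := (d2_diag x y z m' t h).
Local Notation d2_sub := (d2_sub z w m' t h).
Local Notation d3_entry := (d3_entry x y z w m' t h).
Local Notation d1_entry := (d1_entry x y z w m' t h q).
Local Notation continuant := (continuant x y z w t h).

Definition d2mx : 'M[R]_N.+1 := tridiag N.+1 d2_sub d2_diag d2_super.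
Definition d3mx : 'cV[R]_N.+1 := \col_i d3_entry i.
Definition d1mx : 'rV[R]_N.+1 := \row_i d1_entry i.

Lemma d2mx_d3mx : d2mx *m d3mx = 0.
Proof.
apply/colP=> i; rewrite [RHS]mxE -[RHS](d2_d3_row x y z w m' t h i) mxE.
under eq_bigr do rewrite [d3mx _ _]mxE.
rewrite tridiag_row; congr (_ + _); case: ltnP => // leN.
by rewrite d3_entry_tail ?mulr0 //; apply: leq_trans leN; rewrite ltnS leq_addr.
Qed.

Lemma d1mx_d2mx : d1mx *m d2mx = 0.
Proof.
apply/rowP=> j; rewrite [RHS]mxE mxE.
have lejN : (j <= N)%N by rewrite -ltnS.
rewrite -[RHS](@d1_d2_col _ x y z w m' t h q _ lejN).
under eq_bigr do rewrite [d1mx _ _]mxE.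
rewrite tridiag_col; congr (_ + _); case: ltnP => // leN.
by rewrite d2_sub_tail ?mul0r //; apply: leq_trans leN; rewrite ltnS leq_addr.
Qed.

Lemma prod_padpow k : \prod_(i < k.+1) padpow w t h x i = w ^+ h * x ^+ (t + k * d).
Proof.
elim: k => [|k IHk]; first by rewrite big_ord1 /= addn0.
by rewrite big_ord_recr IHk /padpow /= mul1r -mulrA -exprD mulSn; congr (_ * _ ^+ _); lia.
Qed.

(** Up to sign this is the corner of the adjugate of D; equality with the product of the
    end entries of v and f fixes the scalar in [hess_adj]. *)
Lemma prod_d2_super : \prod_(i < N) d2_super i = d3_entry 0 * d1_entry N.
Proof.
rewrite -(big_mkord xpredT) (@big_cat_nat _ _ _ m) //=; last by lia.
rewrite (@big_cat_nat _ _ _ m.*2 m) /=; try lia.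
rewrite big_mkord (eq_bigr (fun=> x ^+ d)); last by move=> i _; rewrite d2_super_up.
rewrite prodr_const card_ord.
have -> : \prod_(m.*2 <= i < N) d2_super i = x ^+ (q * d).
  rewrite (eq_big_nat _ _ (F2 := fun=> x ^+ d)); last first.
    move=> i /andP[lei _]; rewrite /d2_super; have -> : (i < m)%N = false by lia.
    have -> : (i == m)%N = false by lia.
    by rewrite ltnNge lei.
  by rewrite prodr_const_nat addKn -exprM mulnC.
have -> : \prod_(m <= i < m.*2) d2_super i = - (w ^+ h * x ^+ c).
  rewrite -prod_padpow -(big_mkord xpredT) [in RHS]big_nat_rev /= add0n big_ltn; last by lia.
  rewrite [in RHS]big_ltn // -mulNr; congr (_ * _).
    by rewrite /d2_super ltnn eqxx subSS subn0.
  have -> : \prod_(m.+1 <= i < m.*2) d2_super i = \prod_(m.+1 <= i < m.*2) padpow w t h x (m.*2 - i).-1.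
    apply: eq_big_nat => i /andP[ltmi lti2]; rewrite /d2_super lti2.
    have -> : (i < m)%N = false by lia.
    by have -> : (i == m)%N = false by lia.
  have -> : m.+1 = (1 + m)%N by [].
  rewrite -addnn big_addn addnK; apply: eq_big_nat => i /andP[i1 im].
  by congr padpow; lia.
rewrite d1_entry_tail d3_entry_up // /= subn0 mulr1 subnn mul0n expr0 mulr1.
rewrite -exprM.
have -> : (d * m = h + c)%N by rewrite mulnC mulSn; lia.
by rewrite !exprD; ring.
Qed.

(** Every product of opposite off-diagonal entries is divisible by x z when t is
    positive, so only the product of the diagonal survives modulo x z. *)
Lemma continuant_mod i : (0 < t)%N -> exists A, continuant i = y ^+ contdeg t h i + x * z * A.
Proof.
move=> t_gt0.
suff [] : (exists A, continuant i = y ^+ contdeg t h i + x * z * A)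
  /\ (exists A, continuant i.+1 = y ^+ contdeg t h i.+1 + x * z * A) by [].
elim: i => [|i [[A defA] [B defB]]]; first by split; exists 0; rewrite /= ?addn0; ring.
split; first by exists B.
have [e defe] : exists e, rowdeg t h i = e.+1 by case: i {defA defB} => [|i] /=; [exists t.-1|exists d.-1]; lia.
exists (y ^+ d * B - w ^+ rowgap h i * (x * z) ^+ e * continuant i).
rewrite continuant_rec defB defe exprS; have -> : contdeg t h i.+2 = (contdeg t h i.+1 + d)%N by rewrite contdegS.
by rewrite !exprD; ring.
Qed.

End ConstructionMatrices.

(** * Setting a variable to zero *)

Section KillVariable.
Variables (k : fieldType) (r : nat).
Local Notation R := {mpoly k[r]}.

(** Substituting 0 for a variable detects divisibility by it, and its values in a
    domain show at once that the variable is prime. *)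
Definition kill (i : 'I_r) : R -> R :=
  mmap (@mpolyC r k) (fun j => if j == i then 0 else 'X_j).

HB.instance Definition _ i := GRing.RMorphism.copy (kill i) (kill i).

Lemma killX i j : kill i 'X_j = if j == i then 0 else 'X_j.
Proof. by rewrite /kill mmapX mmap1U. Qed.

Lemma killP i p : exists q, p = kill i p + 'X_i * q.
Proof.
pose P (p : R) := exists q, p = kill i p + 'X_i * q.
have PM p1 p2 : P p1 -> P p2 -> P (p1 * p2).
  case=> q1 e1 [q2 e2]; rewrite /P rmorphM /= {1}e1 {1}e2.
  by exists (kill i p1 * q2 + q1 * kill i p2 + 'X_i * q1 * q2); ring.
have PX j : P 'X_j.
  rewrite /P killX; have [->|_] := eqVneq j i; first by exists 1; rewrite add0r mulr1.
  by exists 0; rewrite mulr0 addr0.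
have PC c : P c%:MP by exists 0; rewrite /kill mmapC mulr0 addr0.
elim/mpolyind: p => [|c m p _ _ [q defp]].
  by exists 0; rewrite rmorph0 mulr0 addr0.
have [q1 e1] : P (c *: 'X_[m]).
  rewrite -mul_mpolyC mpolyXE_id; apply: (PM _ _ (PC c)).
  apply: (big_ind P) => [||j _]; [exact: (PC 1) | exact: PM |].
  elim: (m j) => [|e IHe]; first exact: (PC 1).
  by rewrite exprS; apply: PM.
by exists (q1 + q); rewrite rmorphD /= {1}e1 {1}defp; ring.
Qed.

Lemma mpolyX_neq0 (i : 'I_r) : 'X_i != 0 :> R.
Proof. by rewrite -msupp_eq0 msuppX. Qed.

Lemma kill_eq0 i p : kill i p = 0 -> exists q, p = 'X_i * q.
Proof. by have [q {2}->] := killP i p => ->; exists q; rewrite add0r. Qed.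

Lemma kill_var i : kill i 'X_i = 0.
Proof. by rewrite killX eqxx. Qed.

(** A power of a variable is coprime to any p that the variable does not divide. *)
Lemma kill_cancel i e p a b :
  kill i p != 0 -> 'X_i ^+ e * a = p * b -> exists q, b = 'X_i ^+ e * q.
Proof.
move=> p0; elim: e a b => [|e IHe] a b.
  by exists b; rewrite expr0 mul1r.
move=> eqab; have : kill i b = 0.
  move/(congr1 (kill i)): eqab; rewrite !rmorphM /= rmorphXn /= kill_var.
  by rewrite expr0n mul0r => /esym/eqP; rewrite mulf_eq0 (negbTE p0) => /eqP.
case/kill_eq0=> b' defb; have [|q defq] := IHe a b'.
  apply: (mulfI (mpolyX_neq0 i)); rewrite mulrA -exprS eqab defb; ring.
by exists q; rewrite defb defq mulrA -exprS.
Qed.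

Lemma kill_prime_ideal i : prime_ideal [pred p | kill i p == 0].
Proof.
split; last by move=> p1 p2; rewrite !inE rmorphM mulf_eq0.
split=> [||p p1 p2]; first by rewrite inE rmorph0.
  by rewrite inE rmorph1 oner_eq0.
rewrite !inE => /eqP e1 /eqP e2.
by rewrite rmorphD rmorphM /= e1 e2 mulr0 addr0.
Qed.

(** The chain is 0, the ideal of the variable, P. *)
Lemma kill_height i (P : {pred R}) p :
  prime_ideal P -> 'X_i \in P -> p \in P -> kill i p != 0 -> prime_height_ge 2 P.
Proof.
move=> primeP Xi Pp kp; have [[P0 _ PM] _] := primeP.
exists (fun a : 'I_3 => match (a : nat) return {pred R} with
  | 0 => pred1 0 | 1 => [pred p | kill i p == 0] | _ => P end).
split=> [[[|[|[|//]]] lta]|[[|[|[|//]]] lta] [[|[|[|//]]] ltb] //= _|//] /=.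
- exact: zero_prime_ideal.
- exact: kill_prime_ideal.
- exact: primeP.
- split=> [u|]; first by rewrite !inE => /eqP->; rewrite rmorph0.
  by exists 'X_i; rewrite !inE ?kill_var ?mpolyX_neq0.
- split=> [u|]; first by rewrite inE => /eqP->.
  by exists 'X_i; rewrite // !inE mpolyX_neq0.
- split=> [u|]; last by exists p; rewrite ?inE.
  by rewrite inE => /eqP/kill_eq0[u' ->]; rewrite mulrC -[_ * _]addr0; apply: PM.
Qed.

End KillVariable.

(** * Homogeneous ideals from homogeneous generators *)

Section HomogeneousIdeals.
Variables (k : fieldType) (r : nat).
Local Notation R := {mpoly k[r]}.

Lemma dhomog_coeff0 e (p : R) : (0 < e)%N -> p \is e.-homog -> p@_0%MM = 0.
Proof.
by move=> e0 hp; apply: (dhomog_nemf_coeff hp); rewrite mf0 eq_sym -lt0n.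
Qed.

Lemma pihomogMl e e' (g p : R) :
  g \is e.-homog -> exists u, pihomog mdeg e' (g * p) = g * u.
Proof.
move=> hg; elim/mpolyind: p => [|c m p _ _ [u defu]].
  by exists 0; rewrite !mulr0 raddf0.
rewrite mulrDr raddfD /= defu.
suff [u' ->] : exists u', pihomog mdeg e' (g * (c *: 'X_[m])) = g * u'.
  by exists (u' + u); rewrite mulrDr.
have hgm : g * (c *: 'X_[m]) \is (e + mdeg m).-homog.
  by apply: dhomogM => //; rewrite dhomogZ // dhomogX.
have [<-|ne] := eqVneq (e + mdeg m)%N e'.
  by exists (c *: 'X_[m]); apply: pihomog_dE.
by exists 0; rewrite mulr0 (pihomog_ne0 ne hgm).
Qed.

Variables (n e : nat) (f : 'rV[R]_n).
Hypotheses (e_gt0 : (0 < e)%N) (hf : forall j, f 0 j \is e.-homog).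

(** Membership is turned into a boolean by excluded middle. *)
Definition ideal_gen : {pred R} := fun p =>
  if excluded_middle_informative (exists v : 'cV_n, p%:M = f *m v) then true else false.

Lemma ideal_genP p : p \in ideal_gen <-> exists v : 'cV_n, p%:M = f *m v.
Proof. by rewrite unfold_in; case: excluded_middle_informative; split. Qed.

Lemma ideal_gen_sum p : p \in ideal_gen <-> exists v : 'cV_n, p = \sum_j f 0 j * v j 0.
Proof.
split=> [/ideal_genP[v /matrixP/(_ 0 0)]|[v defp]].
  by rewrite !mxE mulr1n; exists v.
by apply/ideal_genP; exists v; apply/matrixP=> i j; rewrite !ord1 !mxE mulr1n.
Qed.

Lemma ideal_gen_homogeneous : homogeneous_ideal ideal_gen.
Proof.
split=> [|p e' /ideal_gen_sum[v ->]]; last first.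
  have /fin_all_exists[u hu] j : exists u, pihomog mdeg e' (f 0 j * v j 0) = f 0 j * u.
    exact: pihomogMl (hf j).
  apply/ideal_gen_sum; exists (\col_j u j); rewrite raddf_sum.
  by apply: eq_bigr => j _; rewrite mxE /= hu.
split=> [||p p1 p2 /ideal_gen_sum[v1 ->] /ideal_gen_sum[v2 ->]].
- by apply/ideal_gen_sum; exists 0; rewrite big1 // => j _; rewrite mxE mulr0.
- apply/negP=> /ideal_gen_sum[v /(congr1 (mcoeff 0%MM))/eqP].
  rewrite mcoeff1 eqxx raddf_sum big1 ?oner_eq0 //= => j _.
  by rewrite rmorphM /= (dhomog_coeff0 e_gt0 (hf j)) mul0r.
- apply/ideal_gen_sum; exists (p *: v1 + v2).
  rewrite mulr_sumr -big_split; apply: eq_bigr => j _.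
  by rewrite !mxE /=; ring.
Qed.

End HomogeneousIdeals.

(** * Exactness, height and degrees of the tridiagonal complex *)

Section ConstructionProperties.
Variables (k : fieldType) (m' t h q : nat).
Hypothesis t_gt0 : (0 < t)%N.
Local Notation R := {mpoly k[4]}.
Local Notation ix := (@Ordinal 4 0 isT).
Local Notation iy := (@Ordinal 4 1 isT).
Local Notation iz := (@Ordinal 4 2 isT).
Local Notation iw := (@Ordinal 4 3 isT).
Local Notation x := ('X_ix : R).
Local Notation y := ('X_iy : R).
Local Notation z := ('X_iz : R).
Local Notation w := ('X_iw : R).
Local Notation d := (t + h)%N.
Local Notation m := m'.+1.
Local Notation c := (t + m' * d)%N.
Local Notation a := (h + h + c + q * d)%N.
Local Notation N := (m.*2 + q)%N.
Local Notation continuant := (continuant x y z w t h).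
Local Notation d1_entry := (d1_entry x y z w m' t h q).
Local Notation d3_entry := (d3_entry x y z w m' t h).
Local Notation D := (d2mx x y z w m' t h q).
Local Notation v := (d3mx x y z w m' t h q).
Local Notation f := (d1mx x y z w m' t h q).

Lemma dhomogXn (i : 'I_4) e : ('X_i : R) ^+ e \is e.-homog.
Proof.
have := @dhomogMn _ _ _ 1%N ('X_i : R) e; rewrite mul1n; apply.
by rewrite dhomogX /= mdeg1.
Qed.

Lemma dhomogM_eq d1 d2 d3 (p1 p2 : R) :
  p1 \is d1.-homog -> p2 \is d2.-homog -> d3 = (d1 + d2)%N -> p1 * p2 \is d3.-homog.
Proof. by move=> h1 h2 ->; apply: dhomogM. Qed.

Lemma continuant_homog i : continuant i \is (contdeg t h i).-homog.
Proof.
suff [] : continuant i \is (contdeg t h i).-homog /\ continuant i.+1 \is (contdeg t h i.+1).-homog by [].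
elim: i => [|i [IH1 IH2]].
  by split; [apply: dhomog1 | rewrite /= addn0; apply: dhomogXn].
split=> //; rewrite continuant_rec rpredB //.
  by apply: (dhomogM_eq (dhomogXn _ _) IH2); rewrite contdegS addnC.
rewrite exprMn; apply: (dhomogM_eq _ IH1 (d1 := rowgap h i + (rowdeg t h i + rowdeg t h i))).
  by do 2?[apply: dhomogM]; apply: dhomogXn.
by rewrite !contdegS; have := rowdeg_gap t h i; rewrite [rowdeg t h i.+1]/=; lia.
Qed.

Lemma padpow_homog (j : 'I_4) i : padpow w t h 'X_j i \is d.-homog.
Proof. by apply: (dhomogM_eq (dhomogXn _ _) (dhomogXn _ _)); rewrite -(rowdeg_gap t h i) addnC. Qed.

Lemma d2mx_homog i j : D i j \is d.-homog.
Proof.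
have hXY (l l' : 'I_4) i' : ('X_l : R) ^+ rowgap h i' * 'X_l' ^+ rowdeg t h i' \is d.-homog.
  by apply: (dhomogM_eq (dhomogXn _ _) (dhomogXn _ _)); rewrite -(rowdeg_gap t h i') addnC.
have hb (b : bool) (p : R) : p \is d.-homog -> b%:R * p \is d.-homog.
  by case: b; rewrite ?mul1r ?mul0r ?dhomog0.
rewrite mxE !rpredD // hb //.
- rewrite /d2_super; do ![case: ifP => _]; rewrite ?dhomogN; by [apply: dhomogXn | apply: padpow_homog].
- rewrite /d2_diag; do ![case: ifP => _]; rewrite ?dhomogN ?dhomog0 //; by [apply: dhomogXn | apply: hXY].
- case: (i : nat) => [|i'] /=; first exact: dhomog0.
  do ![case: ifP => _]; rewrite ?dhomog0 //; by [apply: dhomogXn | apply: padpow_homog].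
Qed.

Lemma d3mx_homog i : v i 0 \is c.-homog.
Proof.
have hl (j : 'I_4) l : (l <= m)%N -> 'X_j ^+ (c - contdeg t h l) * continuant l \is c.-homog.
  move=> lel; apply: (dhomogM_eq (dhomogXn _ _) (continuant_homog _)).
  by rewrite subnK // leq_contdeg.
rewrite mxE /d3_entry; case: leqP => lei; first exact: hl.
by case: leqP => _; rewrite ?dhomog0 // hl //; lia.
Qed.

Lemma d1mx_homog j : f 0 j \is (a)%N.-homog.
Proof.
have hl (j1 j2 : 'I_4) l : (l <= m)%N ->
    w ^+ rowgap h l * 'X_j1 ^+ (h - rowgap h l) * 'X_j2 ^+ (h + (c - contdeg t h l)) * continuant l
      * y ^+ (q * d) \is (a)%N.-homog.
  move=> lel; apply: (dhomogM_eq _ (dhomogXn _ _)); last reflexivity.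
  apply: (dhomogM_eq _ (continuant_homog _)); first by do 2?[apply: dhomogM]; apply: dhomogXn.
  by have := leq_contdeg t h lel; have := rowgap_le h l; lia.
rewrite mxE /d1_entry; case: leqP => lei; first exact: hl.
case: leqP => le2; rewrite dhomogN; first by rewrite hl //; lia.
apply: (dhomogM_eq _ (dhomogXn _ _)); first by apply: dhomogM; apply: dhomogXn.
have lejN : (j <= N)%N by rewrite -ltnS.
have [l def_j] : exists l, (j : nat) = (m.*2 + l)%N by exists (j - m.*2)%N; lia.
rewrite def_j addKn; have : (l <= q)%N by lia.
by move=> /subnK {1}<-; rewrite mulnDl; lia.
Qed.

Lemma kill_neq (i j : 'I_4) e : i != j -> kill i (('X_j : R) ^+ e) = 'X_j ^+ e.
Proof. by move=> ne; rewrite rmorphXn /= killX eq_sym (negbTE ne). Qed.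

Lemma Xn_neq0 (i : 'I_4) e : ('X_i : R) ^+ e != 0.
Proof. by rewrite expf_neq0 ?mpolyX_neq0. Qed.

Lemma kill_x_continuant i : kill ix (continuant i) = y ^+ contdeg t h i.
Proof.
have [A ->] := continuant_mod x y z w h i t_gt0.
by rewrite rmorphD !rmorphM /= kill_var !mul0r addr0 kill_neq.
Qed.

Lemma kill_w_continuant i : kill iw (continuant i) != 0.
Proof.
have [A ->] := continuant_mod x y z w h i t_gt0.
rewrite rmorphD !rmorphM /= !killX /= kill_neq //.
apply: contraTneq (Xn_neq0 iy (contdeg t h i)) => /(congr1 (kill ix)).
rewrite rmorph0 rmorphD !rmorphM /= kill_var !mul0r addr0 kill_neq // => ->.
by rewrite eqxx.
Qed.

Lemma d3mx_0 : v ord0 0 = x ^+ c.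
Proof. by rewrite mxE d3_entry_up // subn0 mulr1. Qed.

Let jm : 'I_N.+1 := inord m.
Let jz : 'I_N.+1 := inord m.*2.

Lemma d3mx_mid : v jm 0 = continuant m.
Proof. by rewrite mxE inordK; [rewrite d3_entry_up // subnn mul1r | lia]. Qed.

Lemma d3mx_2m : v jz 0 = z ^+ c.
Proof.
rewrite mxE inordK; last by lia.
by rewrite -[m.*2]subn0 d3_entry_lo // subn0 mulr1.
Qed.

Lemma d1mx_0 : f 0 ord0 = w ^+ h * (z ^+ (h + c) * y ^+ (q * d)).
Proof. by rewrite mxE d1_entry_up //= subnn subn0 !mulr1 mulrA. Qed.

Lemma d1mx_mid : f 0 jm = x ^+ h * z ^+ h * continuant m * y ^+ (q * d).
Proof. by rewrite mxE inordK; [rewrite d1_entry_up // [rowgap h m]/= [contdeg t h m]/= subnn subn0 addn0 mul1r | lia]. Qed.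

Lemma d1mx_max : f 0 ord_max = - (w ^+ h * x ^+ (h + c + q * d)).
Proof. by rewrite mxE d1_entry_tail subnn mul0n expr0 mulr1. Qed.

Lemma d1mx_max_neq0 : f 0 ord_max != 0.
Proof. by rewrite d1mx_max oppr_eq0 mulf_neq0 ?Xn_neq0. Qed.

Lemma d2mx_hess (i j : 'I_N.+1) : (i.+1 < j)%N -> D i j = 0.
Proof.
move=> ltij; rewrite mxE.
have -> : (j == i.+1 :> nat) = false by lia.
have -> : (j == i :> nat) = false by lia.
have -> : (j.+1 == i :> nat) = false by lia.
by rewrite !mul0r !addr0.
Qed.

Lemma d2mx_super (i j : 'I_N.+1) : j = i.+1 :> nat -> D i j = d2_super x w m' t h i.
Proof.
move=> ji; rewrite mxE ji eqxx.
have -> : (i.+1 == i :> nat) = false by lia.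
have -> : (i.+2 == i :> nat) = false by lia.
by rewrite !mul0r !addr0 mul1r.
Qed.

Lemma d2_super_neq0 i : d2_super x w m' t h i != 0.
Proof.
by rewrite /d2_super; do ![case: ifP => _]; rewrite ?oppr_eq0 ?mulf_neq0 ?Xn_neq0.
Qed.

Lemma d2mx_super_neq0 (i j : 'I_N.+1) : j = i.+1 :> nat -> D i j != 0.
Proof. by move/d2mx_super->; apply: d2_super_neq0. Qed.

Lemma d3mx_0_neq0 : v ord0 0 != 0.
Proof. by rewrite d3mx_0 Xn_neq0. Qed.

Lemma d2mx_adj i j : \adj D i j = (-1) ^+ N * (v i 0 * f 0 j).
Proof.
apply: hess_adj => //; [exact: d2mx_hess | exact: d2mx_super_neq0 | exact: d1mx_d2mx
  | exact: d2mx_d3mx | exact: d3mx_0_neq0 | exact: d1mx_max_neq0 |].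
rewrite [v _ _]mxE [f _ _]mxE -prod_d2_super; apply: eq_bigr => i' _.
by rewrite d2mx_super ?lift_max ?lift0.
Qed.

(** Proportionality to v is [hess_ker]; the scalar is a polynomial because the
    first entry x ^+ c of v is coprime to the middle one, which is a power of y
    modulo x. *)
Lemma d2mx_ker (u : 'cV_N.+1) : D *m u = 0 -> exists e, u = e *: v.
Proof.
move=> Du0; have key i := hess_ker d2mx_hess d2mx_super_neq0 (d2mx_d3mx x y z w m' t h q) i Du0.
have [e ue] : exists e, u ord0 0 = x ^+ c * e.
  have := key jm; rewrite d3mx_0 d3mx_mid mulrC [_ * continuant m]mulrC mulrC => /kill_cancel; apply.
  by rewrite kill_x_continuant Xn_neq0.
exists e; apply/colP=> i; have := key i; rewrite d3mx_0 ue mxE -mulrA.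
by move/(mulfI (Xn_neq0 _ _)) => ->; rewrite !mxE.
Qed.

(** The last and the first entry of f have the common factor w ^+ h only, and w
    does not divide the middle entry. *)
Lemma d1mx_grade (u : 'I_N.+1 -> R) :
  (forall i j, u i * f 0 j = u j * f 0 i) -> exists e, forall i, u i = f 0 i * e.
Proof.
move=> uf; have [e1 uN] : exists e, u ord_max = x ^+ (h + c + q * d) * e.
  have /eqP := uf ord0 ord_max; rewrite d1mx_0 d1mx_max.
  rewrite -subr_eq0 (_ : _ - _ = w ^+ h * (- (x ^+ (h + c + q * d) * u ord0
     + (z ^+ (h + c) * y ^+ (q * d)) * u ord_max))); last by ring.
  rewrite mulf_eq0 (negbTE (Xn_neq0 _ _)) oppr_eq0 addr_eq0 => /eqP eqx.
  apply: (@kill_cancel _ _ _ _ (- (z ^+ (h + c) * y ^+ (q * d))) (u ord0)).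
    by rewrite rmorphN rmorphM /= !kill_neq // oppr_eq0 mulf_neq0 ?Xn_neq0.
  by rewrite eqx mulNr.
have [e2 defe1] : exists e, e1 = w ^+ h * e.
  apply: (kill_cancel (p := f 0 jm) (a := - u jm)).
    rewrite d1mx_mid; move: (continuant m) (kill_w_continuant m) => g kg.
    by rewrite !rmorphM /= !kill_neq // !mulf_neq0 ?Xn_neq0.
  apply: (mulfI (Xn_neq0 ix (h + c + q * d))).
  transitivity (u jm * f 0 ord_max); first by rewrite d1mx_max; ring.
  by rewrite uf uN; ring.
have uNf : u ord_max = f 0 ord_max * - e2 by rewrite uN d1mx_max defe1; ring.
exists (- e2) => i; apply: (mulIf d1mx_max_neq0).
by rewrite uf uNf; ring.
Qed.

Lemma reg_xz p1 p2 : z ^+ c * p2 = x ^+ c * p1 -> exists e : R, p2 = x ^+ c * e.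
Proof. by move/esym/kill_cancel; apply; rewrite kill_neq ?Xn_neq0. Qed.

Lemma reg_xzy e p p1 p2 : y ^+ e * p = x ^+ c * p1 + z ^+ c * p2 ->
  exists p1' p2' : R, p = x ^+ c * p1' + z ^+ c * p2'.
Proof.
elim: e p p1 p2 => [|e IHe] p p1 p2 eqp.
  by exists p1, p2; rewrite -eqp expr0 mul1r.
have [r1 def1] := killP iy p1; have [r2 def2] := killP iy p2.
apply: (IHe p r1 r2); apply: (mulfI (mpolyX_neq0 k iy)).
rewrite mulrA -exprS eqp.
have /(congr1 (kill iy)) := eqp; rewrite rmorphD !rmorphM /= !rmorphXn /= kill_var.
rewrite expr0n mul0r !killX /= => eq0.
by rewrite {1}def1 {1}def2 2!mulrDr addrACA -eq0; ring.
Qed.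

(** Since the continuant is y ^+ c modulo x z, a power of y lies in the ideal of the
    continuant and x ^+ c; so it suffices that y is a nonzerodivisor modulo
    x ^+ c and z ^+ c. *)
Lemma reg_xzU p p1 p2 : continuant m * p = x ^+ c * p1 + z ^+ c * p2 ->
  exists p1' p2' : R, p = x ^+ c * p1' + z ^+ c * p2'.
Proof.
have [A defU] := continuant_mod x y z w h m t_gt0; move: (continuant m) defU => u defU equ.
have powE e : exists E, y ^+ (contdeg t h m * e) = u * E + (- (x * z * A)) ^+ e.
  elim: e => [|e [E IHe]]; first by exists 0; rewrite muln0 !expr0; ring.
  exists (E * y ^+ contdeg t h m + (- (x * z * A)) ^+ e).
  by rewrite mulnS exprD IHe exprS defU; ring.
have [E {}powE] := powE c.
apply: (@reg_xzy (contdeg t h m * c)%N p (E * p1 + (- (z * A)) ^+ c * p) (E * p2)).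
rewrite powE (_ : - (x * z * A) = x * - (z * A)); last by ring.
rewrite exprMn mulrDl [u * E]mulrC -mulrA equ; ring.
Qed.

Lemma d1mx_exact : exact_at f D.
Proof.
move=> u; split=> [fu0|[e ->]]; last by rewrite mulmxA d1mx_d2mx mul0mx.
apply: (@exact_of_grades _ _ _ _ _ _ (d1mx_d2mx x y z w m' t h q) (d2mx_d3mx x y z w m' t h q)
  _ d2mx_adj d2mx_ker d1mx_grade _ ord0 jz jm) => //.
- by rewrite -exprMn mulrNN mulr1 expr1n.
- by exists ord_max; apply: d1mx_max_neq0.
- exact: d3mx_0_neq0.
- by rewrite d3mx_2m Xn_neq0.
- apply: contraTneq (Xn_neq0 iy (contdeg t h m)) => vm0.
  by rewrite -kill_x_continuant -d3mx_mid vm0 (rmorph0 (kill ix)) eqxx.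
- by move=> p1 p2; rewrite d3mx_2m d3mx_0; apply: reg_xz.
- by move=> p p1 p2; rewrite d3mx_2m d3mx_0 d3mx_mid; apply: reg_xzU.
Qed.

(** A prime ideal containing the last entry of f contains w or x.  The middle entry
    of f is not divisible by w, nor the first entry by x. *)
Lemma d1mx_height : height_ge 2 (ideal_gen f).
Proof.
move=> P primeP subP; have [_ primeM] := primeP.
have fP j : f 0 j \in P.
  apply: subP; apply/ideal_gen_sum; exists (delta_mx j 0).
  rewrite (bigD1 j) //= [delta_mx _ _ _ _]mxE !eqxx mulr1 big1 ?addr0 // => l /negbTE nlj.
  by rewrite [delta_mx _ _ _ _]mxE nlj mulr0.
have varP (i : 'I_4) e : 'X_i ^+ e \in P -> 'X_i \in P by apply: prime_ideal_exp.
have : w ^+ h * x ^+ (h + c + q * d) \in P.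
  have [[P0 _ PM] _] := primeP.
  have := PM (-1) _ _ (fP ord_max) P0.
  by rewrite d1mx_max mulN1r opprK addr0.
case/primeM/orP => /varP inP.
- apply: (kill_height primeP inP (fP jm)).
  rewrite d1mx_mid; move: (continuant m) (kill_w_continuant m) => g kg.
  by rewrite !rmorphM /= !kill_neq // !mulf_neq0 ?Xn_neq0.
- apply: (kill_height primeP inP (fP ord0)).
  by rewrite d1mx_0 !rmorphM /= !kill_neq // !mulf_neq0 ?Xn_neq0.
Qed.

Lemma construction_essential (a_ b_ : 'I_N.+1 -> nat) :
    (0 < d)%N -> (forall i, a_ i = a) -> (forall j, b_ j = (a + d)%N) ->
  essential_Betti_sequence k a_ b_ (a + d + c).
Proof.
move=> d_gt0 ha hb; have c_gt0 : (0 < c)%N by rewrite ltn_addr.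
have a_gt0 : (0 < a)%N by rewrite ltn_addr // ltn_addl.
exists 4%N => //; exists (ideal_gen f); split; last (exists f, D, v; split; split).
- exact: ideal_gen_homogeneous a_gt0 d1mx_homog.
- exact: d1mx_height.
- by apply/graded_mapP=> i j; rewrite ord1 ha leq0n subn0; apply: d1mx_homog.
- by apply/graded_mapP=> i j; rewrite ha hb leq_addr addKn; apply: d2mx_homog.
- by apply/graded_mapP=> i j; rewrite hb leq_addr addKn ord1; apply: d3mx_homog.
- by move=> i j; rewrite ord1; apply: dhomog_coeff0 a_gt0 (d1mx_homog _).
- by move=> i j; apply: dhomog_coeff0 d_gt0 (d2mx_homog _ _).
- by move=> i j; rewrite ord1; apply: dhomog_coeff0 c_gt0 (d3mx_homog _).
- exact: ideal_genP.
- exact: d1mx_exact.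
- move=> u; split=> [/d2mx_ker[e ->]|[e ->]].
    by exists e%:M; rewrite mul_mx_scalar.
  by rewrite mulmxA d2mx_d3mx mul0mx.
- move=> u /matrixP vu0; apply/matrixP=> i j; rewrite !ord1 [RHS]mxE.
  have := vu0 ord0 0; rewrite !mxE big_ord1 => /eqP.
  by have := d3mx_0_neq0; rewrite mxE => v0; rewrite mulf_eq0 (negbTE v0) => /eqP.
Qed.

End ConstructionProperties.

(** * The characterization *)

Theorem theorem4p14 (k : fieldType) (n : nat) (hn3 : (3 <= n)%N)
    (hodd : odd n) (a_ b_ : 'I_n -> nat) (a b s : nat)
    (ha : (0 < a)%N) (hb : (0 < b)%N) (hs : (0 < s)%N)
    (ha_ : forall i, a_ i = a) (hb_ : forall j, b_ j = b) :
  essential_Betti_sequence k a_ b_ s <->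
  s%:Z = n%:Z * (b%:Z - a%:Z) /\
  ((n * a < (n - 1) * b)%N /\ ((n - 1) * b <= (n + 1) * a)%N).
Proof.
have [M defn] : exists M, n = M.*2.+1 by exists n./2; rewrite -[LHS]odd_double_half hodd.
split.
  case/(essential_Betti_necessary (ltnW hn3) ha_ hb_) => c [d [-> -> c_gt0 deg leca]].
  rewrite defn /= in deg *; nia.
case=> defs [lo hi].
have ltab : (a < b)%N by nia.
have [d def_b] : exists d, b = (a + d)%N by exists (b - a)%N; lia.
have d_gt0 : (0 < d)%N by lia.
have [c def_s] : exists c, s = (b + c)%N by exists (s - b)%N; nia.
have c_gt0 : (0 < c)%N by nia.
have deg : (M.*2 * d = a + c)%N by nia.
have leca : (c <= M * d)%N by nia.
(* Dividing c - 1 rather than c keeps t in the interval from 1 to d. *)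
pose m' := (c.-1 %/ d)%N; pose t := (c.-1 %% d).+1.
have def_c : c = (t + m' * d)%N by have := divn_eq c.-1 d; rewrite /t /m'; lia.
have let_d : (t <= d)%N by rewrite ltn_pmod.
have ltm'M : (m' < M)%N by rewrite ltn_divLR //; lia.
have [h def_d] : exists h, d = (t + h)%N by exists (d - t)%N; lia.
have [q def_n] : exists q, n = (m'.+1.*2 + q).+1 by exists (n - m'.+1.*2.+1)%N; lia.
have def_a : a = (h + h + c + q * d)%N by nia.
have t_gt0 : (0 < t)%N by [].
move: t m' t_gt0 def_c let_d ltm'M def_d def_n => t m' t_gt0 def_c _ _ def_d def_n.
clear defn; subst n s b; rewrite def_a def_c def_d in ha_ hb_ *.
by apply: construction_essential => //; rewrite -def_d.
Qed.
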